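(* Let $p\in(0,1)$, $q=1-p$, $x\in\mathbb{R}$ and $a\in(0,1)$. Put $m_n=\lfloor n/p-xn^a\rfloor$. 1. If $a\in(0,\tfrac12]$, then for every $k\in\mathbb{N}$ $$\varlimsup_{n\to\infty}\mathbb{P}\bigl\{R^{(\mathrm{ind})}_{m_n,n}\ge k\bigr\}\le\begin{cases}2^{-k}, & a<\tfrac12,\\ \bigl(\Phi(xpq^{-1/2})\bigr)^k, & a=\tfrac12,\end{cases}$$ where $\Phi$ is the cumulative distribution function of the standard Gaussian distribution. 2. If $a\in(\tfrac12,\tfrac34]$, there exists a constant $C_1=C_1(x,p)$ such that $$\lim_{n\to\infty}\mathbb{P}\bigl\{R^{(\mathrm{ind})}_{m_n,n}>C_1n^{2a-1}\bigr\}=0.$$ 3. If $a\in(\tfrac34,1)$, there exists a constant $C_2=C_2(x,p)$ such that $$\lim_{n\to\infty}\mathbb{P}\bigl\{R^{(\mathrm{ind})}_{m_n,n}>C_2n^{2a/3}\bigr\}=0.$$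
   Context: Independent model: $\omega=(\omega_{i,j})_{i,j\ge 1}$ is a field of i.i.d. Bernoulli random variables with $\mathbb{P}\{\omega_{i,j}=1\}=p=1-\mathbb{P}\{\omega_{i,j}=0\}$. An admissible path from $(0,0)$ to $(m,n)$ is a lattice path whose increments all lie in $\{e_1,e_2,e_1+e_2\}$. For an admissible path $\pi$, a match is a step $e_1+e_2$ whose endpoint $(i,j)$ has $\omega_{i,j}=1$, a mismatch is a step $e_1+e_2$ whose endpoint has $\omega_{i,j}=0$, and a gap is a step $e_1$ or $e_2$. Let $x(\pi),y(\pi),z(\pi)$ be the numbers of mismatches, gaps and matches of $\pi$. Optimality regions (with mismatch penalty $\alpha=0$): for a gap penalty $\beta\ge 0$ the score of $\pi$ is $z(\pi)-\beta y(\pi)$. Let $\Gamma^{(\beta)}_{0,(m,n)}$ be the set of minimal-gap maximisers, i.e. the paths from $(0,0)$ to $(m,n)$ that maximise the score and, among the maximisers, have the smallest number of gaps. Two penalties $\beta,\beta'$ lie in different optimality regions iff $\Gamma^{(\beta)}_{0,(m,n)}\cap\Gamma^{(\beta')}_{0,(m,n)}=\varnothing$. The critical penalties $0<\beta_1<\dots<\beta_{R}<\infty$ are the values of $\beta>0$ at which the optimality region changes as $\beta$ increases, and $R=R^{(\mathrm{ind})}_{m,n}$ is the number of these critical penalties. *)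

(* Defs.v *)
From HB Require Import structures.
From mathcomp Require Import all_boot all_order all_algebra finmap.
From mathcomp Require Import all_classical all_reals all_analysis.
From mathcomp Require Import lra.

Set Implicit Arguments.
Unset Strict Implicit.
Unset Printing Implicit Defensive.

Import Order.TTheory GRing.Theory Num.Theory.
Import numFieldNormedType.Exports.

Local Open Scope classical_set_scope.
Local Open Scope ring_scope.

Definition mutually_independent (R : realType) (d d' : measure_display)
    (T : measurableType d) (T' : measurableType d') (P : probability T R)
    (I : choiceType) (D : set I) (X : I -> {RV P >-> T'}) : Prop :=
  forall (J : {fset I}) (B : I -> set T'),
    [set` J] `<=` D -> (forall i, measurable (B i)) ->
    P (\bigcap_(i in [set` J]) (X i @^-1` B i))
    = (\prod_(i <- J) P (X i @^-1` B i))%E.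

(* The sites of the environment are the (i, j) with i, j >= 1; the variables
   [omega (i, j)] with i = 0 or j = 0 are unconstrained and no path reads
   them. *)
Definition sites : set (nat * nat) :=
  [set v | (0 < v.1)%N /\ (0 < v.2)%N].

Definition iid_bernoulli (R : realType) (p : R) (d : measure_display)
    (T : measurableType d) (P : probability T R)
    (omega : nat * nat -> {RV P >-> bool}) : Prop :=
  (forall v, sites v -> distribution P (omega v) =1 bernoulli_prob p) /\
  mutually_independent sites omega.

(* Increments e_1, e_2 and e_1 + e_2; an admissible path starting at a given
   site is the list of its increments. *)
Inductive step : Type := StepE1 | StepE2 | StepE12.

Definition move (v : nat * nat) (e : step) : nat * nat :=
  match e with
  | StepE1 => (v.1.+1, v.2)
  | StepE2 => (v.1, v.2.+1)
  | StepE12 => (v.1.+1, v.2.+1)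
  end.

Definition is_gap (e : step) : bool := if e is StepE12 then false else true.

Definition paths_to (m n : nat) : set (seq step) :=
  [set s | foldl move (0%N, 0%N) s = (m, n)].

Definition gaps (s : seq step) : nat := count is_gap s.

Fixpoint matches_from (w : nat * nat -> bool) (v : nat * nat) (s : seq step)
    : nat :=
  if s is e :: s' then
    ((~~ is_gap e && w (move v e)) + matches_from w (move v e) s')%N
  else 0%N.

Definition matches (w : nat * nat -> bool) (s : seq step) : nat :=
  matches_from w (0%N, 0%N) s.

Section Regions.
Variables (R : realType) (w : nat * nat -> bool) (m n : nat).

Definition score (beta : R) (s : seq step) : R :=
  (matches w s)%:R - beta * (gaps s)%:R.

Definition maximisers (beta : R) : set (seq step) :=
  [set s | paths_to m n s /\
           forall s', paths_to m n s' -> score beta s' <= score beta s].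

Definition mingap_maximisers (beta : R) : set (seq step) :=
  [set s | maximisers beta s /\
           forall s', maximisers beta s' -> (gaps s <= gaps s')%N].

Definition different_regions (beta beta' : R) : Prop :=
  mingap_maximisers beta `&` mingap_maximisers beta' = set0.

(* The region changes at [beta] when every neighbourhood of [beta] contains two
   penalties lying in different regions. *)
Definition critical_penalties : set R :=
  [set beta | 0 < beta /\
    forall eps : R, 0 < eps -> exists beta1 beta2 : R,
      [/\ 0 <= beta1, beta - eps < beta1, beta1 < beta2, beta2 < beta + eps
        & different_regions beta1 beta2]].

(* [fset_set] of an infinite set is empty, but [critical_penalties] is finite
   (lemma [finite_critical_penalties]). *)
Definition num_critical : nat := #|` fset_set critical_penalties|.

Let bound := (m + n).+1.

Let ratio (u : 'I_bound * 'I_bound * 'I_bound * 'I_bound) : R :=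
  (u.1.1.1%:R - u.1.1.2%:R) / (u.1.2%:R - u.2%:R).

Let size_path s : paths_to m n s -> (size s <= m + n)%N.
Proof.
have sizeE v : ((size s + v.1 + v.2) <=
    (foldl move v s).1 + (foldl move v s).2)%N.
  elim: s v => [|e s IH] v //=; apply: leq_trans (IH _).
  by case: e => /=; rewrite ?addSn ?addnS.
by rewrite /paths_to /= => e; have := sizeE (0, 0)%N; rewrite e !addn0.
Qed.

Let gaps_lt s : paths_to m n s -> (gaps s < bound)%N.
Proof.
by move=> ps; rewrite ltnS (leq_trans (count_size _ _))// size_path.
Qed.

Let matches_lt s : paths_to m n s -> (matches w s < bound)%N.
Proof.
move=> ps; rewrite ltnS; apply: leq_trans (size_path ps).
rewrite /matches; elim: s (0, 0)%N {ps} => [|e s IH] v //=.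
by rewrite -add1n leq_add ?leq_b1 ?IH.
Qed.

Lemma mingap_maximisers_neq0 (beta : R) : mingap_maximisers beta !=set0.
Proof.
pose s0 := nseq m StepE1 ++ nseq n StepE2.
have ps0 : paths_to m n s0.
  rewrite /paths_to /= foldl_cat.
  have f1 k i j : foldl move (i, j) (nseq k StepE1) = (i + k, j)%N.
    by elim: k i => [|k IH] i /=; rewrite ?addn0// IH addSnnS.
  have f2 k i j : foldl move (i, j) (nseq k StepE2) = (i, j + k)%N.
    by elim: k j => [|k IH] j /=; rewrite ?addn0// IH addSnnS.
  by rewrite f1 f2.
pose T := ('I_bound * 'I_bound)%type.
pose of_path s (ps : paths_to m n s) : T :=
  (Ordinal (gaps_lt ps), Ordinal (matches_lt ps)).
pose A : pred T := fun u => `[< exists2 s, paths_to m n s &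
  gaps s = u.1 /\ matches w s = u.2 >].
have A0 : A (of_path _ ps0) by apply/asboolP; exists s0.
pose f (u : T) : R := u.2%:R - beta * u.1%:R.
case: (Order.TotalTheory.arg_maxP f A0) => u /asboolP[s ps [gs ms]] umax.
have As : A (of_path _ ps) by apply/asboolP; exists s.
pose B : pred T := fun u => A u && (f u == f (of_path _ ps)).
have Bs : B (of_path _ ps) by rewrite /B As eqxx.
have maxs s' : paths_to m n s' -> score beta s' <= score beta s.
  move=> ps'; have /umax : A (of_path _ ps') by apply/asboolP; exists s'.
  by rewrite /f /score /= gs ms.
have [v /andP[/asboolP[t pt [gt mt]] /eqP fv] vmin] :=
  @arg_minnP _ (of_path _ ps) B (fun u => u.1) Bs.
have ts : score beta t = score beta s.
  by rewrite /score gt mt -[LHS]/(f v) fv.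
exists t; split.
  by split=> // s' ps'; rewrite ts; exact: maxs.
move=> s' [ps' maxs']; rewrite gt.
apply: (vmin (of_path _ ps')); apply/andP; split.
  by apply/asboolP; exists s'.
by rewrite -[_ == _]/(score beta s' == score beta s) eq_le maxs//= maxs'.
Qed.

Lemma finite_critical_penalties : finite_set critical_penalties.
Proof.
apply: (@sub_finite_set _ _ (range ratio)); last first.
  exact/finite_image/finite_finset.
move=> beta [_ crit]; apply: contrapT => nbeta.
have cl : closed (range ratio).
  have /accessible_finite_set_closed := hausdorff_accessible (@Rhausdorff R).
  by apply; exact/finite_image/finite_finset.
have /open_nbhs_nbhs : open_nbhs beta (~` range ratio).
  by split=> //; exact: closed_openC.
move=> /nbhs_ballP[eps /= eps0 beps].
have {}beps r : beta - eps < r < beta + eps -> ~ range ratio r.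
  by move=> /andP[r1 r2]; apply: beps; rewrite /ball/= ltr_distlC r1 r2.
have trans b b' s s' : beta - eps < b < beta + eps ->
    beta - eps < b' < beta + eps -> paths_to m n s -> paths_to m n s' ->
    score b s <= score b s' -> score b' s <= score b' s'.
  move=> hb hb' ps ps' le1; rewrite leNgt; apply/negP => lt2.
  pose dz : R := (matches w s)%:R - (matches w s')%:R.
  pose dy : R := (gaps s)%:R - (gaps s')%:R.
  have h1 : dz <= b * dy by move: le1; rewrite /score /dz /dy; lra.
  have h2 : b' * dy < dz by move: lt2; rewrite /score /dz /dy; lra.
  have rr : range ratio (dz / dy).
    by exists (Ordinal (matches_lt ps), Ordinal (matches_lt ps'),
               Ordinal (gaps_lt ps), Ordinal (gaps_lt ps')).
  apply: (beps (dz / dy)) rr.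
  move: hb hb' => /andP[? ?] /andP[? ?].
  have [dy0|dy0|dy0] := ltgtP dy 0; last by move: h1 h2; rewrite dy0; lra.
  - have ? : b <= dz / dy by rewrite ler_ndivlMr.
    have ? : dz / dy < b' by rewrite ltr_ndivrMr.
    by apply/andP; split; lra.
  - have ? : dz / dy <= b by rewrite ler_pdivrMr.
    have ? : b' < dz / dy by rewrite ltr_pdivlMr.
    by apply/andP; split; lra.
have [b [b' [_ h1 h2 h3 dis]]] := crit _ eps0.
have hb : beta - eps < b < beta + eps by apply/andP; split; lra.
have hb' : beta - eps < b' < beta + eps by apply/andP; split; lra.
have submax c c' s : beta - eps < c < beta + eps ->
    beta - eps < c' < beta + eps -> maximisers c s -> maximisers c' s.
  move=> hc hc' [ps maxs]; split=> // s' ps'.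
  by apply: (trans c) => //; exact: maxs.
have [s [ms mins]] := mingap_maximisers_neq0 b.
suff : set0 s by [].
rewrite -dis; split=> //; split; first exact: (submax b).
by move=> s' /(submax b' b _ hb' hb); exact: mins.
Qed.

End Regions.

Definition Phi (R : realType) (y : R) : R :=
  fine (normal_prob 0 1 `]-oo, y]).

(* For [a < 1] the real number [n / p - x * n ^ a] is nonnegative for all large
   [n], and then [Num.truncn] is its floor. *)
Definition m_ (R : realType) (p x a : R) (n : nat) : nat :=
  Num.truncn (n%:R / p - x * n%:R `^ a).

(* Main.v *)
From HB Require Import structures.
From mathcomp Require Import all_boot all_order all_algebra finmap.
From mathcomp Require Import all_classical all_reals all_analysis.
From mathcomp Require Import zify ring lra.
Require Import Defs.

(** Write [f] for the largest number of matches of a path with [n] diagonal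
steps, that is, of a path with the fewest possible gaps.  Everything follows
from the fact that [n - f], the least number [j] of mismatches of such a path,
controls the number of critical penalties, and from a sharp estimate of [j].

As the penalty grows, the optimal paths save gaps and lose matches.  At each
critical penalty at least one match is lost, and the loss ends at [f] or above,
so there are at most [j] critical penalties ([num_critical_le]).  Moreover the
vectors (gaps saved, matches lost) have different slopes, hence are distinct,
while their entries add up to at most [3 * j]; so there are only of the order of
[j ^ (2 / 3)] of them ([num_critical_cube]).

To estimate [j], let [k] lines climb the rows.  The line with [i] mismatches
keeps the leftmost column that is reachable with [i] mismatches: in each row it
moves to the next match, or takes the place diagonally above the line with
[i - 1] mismatches.  The lines search disjoint sites in each row, and the
alternative only helps them, so they all run out of the [m] columns with at most
the probability that [k] independent greedy lines do ([mean_update_le]).  Hence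
the probability of at least [k] critical penalties is at most
[death p m.+1 n ^+ k], where [death p m.+1 n] is the probability that [m]
Bernoulli trials have fewer than [n] successes ([prob_num_critical_ge]).  For
[a <= 1 / 2] the first claim is then the central limit theorem ([death_clt]).
It is proved by comparing the recursion of the binomial distribution function
with the solution [Phi (y / sqrt s)] of the heat equation
([heat_bernoulli_step]).

For [a > 1 / 2] and [x > 0] one greedy line dies with probability close to 1.
The box is therefore cut into about [n ^ (2 a - 1)] blocks along a staircase, each so small
that its share of the deficit [x * n ^ a] of columns is of the order of the
fluctuations of one line ([blocks_fit]).  In each block a single line survives
with probability bounded below ([death_block_lt1]), so the number of mismatches
in a block has a geometric tail, uniformly in [n].  The blocks are independent,
and an exponential Markov inequality shows that [j] is of order [n ^ (2 a - 1)]
with high probability ([few_mismatches]).  The linear bound gives the second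
claim, and the bound by [j ^ (2 / 3)] gives the third, as [2 a - 1 <= a]. *)

Set Implicit Arguments.
Unset Strict Implicit.
Unset Printing Implicit Defensive.

Import Order.TTheory GRing.Theory Num.Theory.
Import numFieldNormedType.Exports.

Local Open Scope classical_set_scope.
Local Open Scope ring_scope.

(** * Critical penalties and lost matches *)

Definition diagonals (s : seq step) : nat := count (predC is_gap) s.

Lemma gaps_diagonals m n s : paths_to m n s ->
  (gaps s + 2 * diagonals s = m + n)%N.
Proof.
suff gen v : ((foldl move v s).1 + (foldl move v s).2 =
    v.1 + v.2 + gaps s + 2 * diagonals s)%N.
  by rewrite /paths_to /= => e; have := gen (0, 0)%N; rewrite e /=; lia.
elim: s v => [|e s IH] v /=; first by rewrite /gaps /diagonals /=; lia.
by rewrite IH; case: e; rewrite /gaps /diagonals /=; lia.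
Qed.

Lemma diagonals_le m n s : paths_to m n s -> (diagonals s <= n)%N.
Proof.
suff gen v : (diagonals s + v.2 <= (foldl move v s).2)%N.
  by rewrite /paths_to /= => e; have := gen (0, 0)%N; rewrite e /=; lia.
elim: s v => [|e s IH] v /=; first by rewrite /diagonals /=; lia.
by apply: leq_trans (IH _); case: e; rewrite /diagonals /=; lia.
Qed.

Lemma matches_from_le w v s : (matches_from w v s <= diagonals s)%N.
Proof.
rewrite /diagonals; elim: s v => [|e s IH] v //=.
rewrite leq_add//.
by case: e => //=; case: (w _).
Qed.

Section CountingRegions.
Variables (R : realType) (w : nat * nat -> bool) (m n : nat).

Let opt (b : R) : seq step := projT1 (cid (mingap_maximisers_neq0 w m n b)).

Let optP b : mingap_maximisers w m n b (opt b).
Proof. by rewrite /opt; case: cid. Qed.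

Let opt_path b : paths_to m n (opt b).
Proof. by have [[]] := optP b. Qed.

Let Y b := gaps (opt b).
Let Z b := matches w (opt b).

(** Penalty [b] prefers the path with more gaps and penalty [b'] the one with
fewer, so the matches bought per additional gap lie between the two penalties.
The rule for ties makes the first inequality strict. *)
Let exchange_rate b b' : (Y b' < Y b)%N ->
  b * ((Y b)%:R - (Y b')%:R) < (Z b)%:R - (Z b')%:R /\
  (Z b)%:R - (Z b')%:R <= b' * ((Y b)%:R - (Y b')%:R).
Proof.
move=> Ylt; have [[_ max'] _] := optP b'.
have := max' _ (opt_path b); rewrite /score -/(Y b) -/(Y b') -/(Z b) -/(Z b').
move=> le'; split; last by lra.
rewrite ltNge; apply/negP => le.
have mx : maximisers w m n b (opt b').
  split=> // s ps; have [[_ /(_ _ ps) + _]] := optP b.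
  rewrite /score -/(Y b) -/(Y b') -/(Z b) -/(Z b') => /le_trans; apply.
  by lra.
by have [_ /(_ _ mx)] := optP b; rewrite leqNgt Ylt.
Qed.

Let Y_noninc b b' : b <= b' -> (Y b' <= Y b)%N.
Proof.
move=> bb; rewrite leqNgt; apply/negP => lt.
have [h1 h2] := exchange_rate lt.
have : ((Y b)%:R : R) < (Y b')%:R by rewrite ltr_nat.
nra.
Qed.

Let same_region b b' : Y b = Y b' -> ~ different_regions w m n b b'.
Proof.
move=> YY dis; suff : set0 (opt b) by [].
rewrite -dis; split; first exact: optP.
have [[_ max] _] := optP b; have [[_ max'] min'] := optP b'.
have := max _ (opt_path b'); have := max' _ (opt_path b).
rewrite /score -/(Y b) -/(Y b') -/(Z b) -/(Z b') YY => le' le.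
split; last by move=> s /min'; rewrite -/(Y b) YY.
split=> // s /max'; rewrite /score -/(Y b) -/(Y b') -/(Z b) -/(Z b') YY.
by lra.
Qed.

Let critical_drop b c b' : b < c -> c < b' ->
  critical_penalties w m n c -> (Y b' < Y b)%N.
Proof.
move=> bc cb' [_ crit].
have e0 : 0 < Num.min (c - b) (b' - c) by rewrite lt_min !subr_gt0 bc cb'.
have [b1 [b2 [_ h1 h12 h2 dis]]] := crit _ e0.
have b_b1 : b < b1 by have : Num.min (c - b) (b' - c) <= c - b; [rewrite ge_min lexx|lra].
have b2_b' : b2 < b'.
  by have : Num.min (c - b) (b' - c) <= b' - c; [rewrite ge_min lexx orbT|lra].
have := Y_noninc (ltW b_b1); have := Y_noninc (ltW h12).
have := Y_noninc (ltW b2_b').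
have : Y b1 <> Y b2 by move/same_region.
by lia.
Qed.

(** The grid [e] is 0, then the critical penalties in increasing order, then one
   value beyond them; [mid i] lies between its entries [i] and [i + 1], so that
   exactly one critical penalty separates consecutive values of [mid]. *)
Let crit := fset_set (critical_penalties (R := R) w m n).
Let r := size crit.
Let c := sort <=%R crit.
Let e := 0 :: rcons c (last 0 c + 1).
Let mid i := (nth 0 e i + nth 0 e i.+1) / 2.

Let size_c : size c = r. Proof. by rewrite size_sort. Qed.

Let crit_c i : (i < r)%N -> critical_penalties w m n (nth 0 c i).
Proof.
rewrite -size_c => /(mem_nth 0); rewrite mem_sort.
by rewrite in_fset_set ?inE//; exact: finite_critical_penalties.
Qed.

Let e_sorted : sorted <%R e.
Proof.
rewrite /e /= rcons_path; apply/andP; split; last first.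
  by rewrite ltrDl.
rewrite path_min_sorted.
  by rewrite lt_sorted_uniq_le sort_uniq fset_uniq sort_le_sorted.
apply/allP => x; rewrite mem_sort.
rewrite in_fset_set ?inE; first by case.
exact: finite_critical_penalties.
Qed.

Let e_lt i j : (i < j <= r.+1)%N -> nth 0 e i < nth 0 e j.
Proof.
move=> /andP[ij jr]; apply: (sorted_ltn_nth lt_trans 0 e_sorted) => //.
- by rewrite inE /= size_rcons size_c; lia.
- by rewrite inE /= size_rcons size_c; lia.
Qed.

Let mid_lt i : (i <= r)%N -> nth 0 e i < mid i < nth 0 e i.+1.
Proof.
move=> ir; have : nth 0 e i < nth 0 e i.+1 by apply: e_lt; lia.
by rewrite /mid => ?; apply/andP; split; lra.
Qed.

Let mid_homo i j : (i <= j <= r)%N -> mid i <= mid j.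
Proof.
move=> /andP[]; rewrite leq_eqVlt => /predU1P[->//|ij] jr; apply: ltW.
have /andP[_ h1] : nth 0 e i < mid i < nth 0 e i.+1 by apply: mid_lt; lia.
have /andP[h2 _] := mid_lt jr.
apply: (lt_le_trans h1); apply: le_trans (ltW h2).
move: ij; rewrite leq_eqVlt => /predU1P[->//|ij].
by apply/ltW/e_lt; lia.
Qed.

Let y i := (Y (mid i) - Y (mid i.+1))%N.
Let z i := (Z (mid i) - Z (mid i.+1))%N.

Let Y_mid i : (i < r)%N -> (Y (mid i.+1) < Y (mid i))%N.
Proof.
move=> ir; apply: (@critical_drop _ (nth 0 e i.+1)).
- by have /andP[] : nth 0 e i < mid i < nth 0 e i.+1 by apply: mid_lt; lia.
- by have /andP[] := mid_lt ir.
- by rewrite /e /= nth_rcons size_c ir; exact: crit_c.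
Qed.

Let mid_gt0 i : (i <= r)%N -> 0 < mid i.
Proof.
move=> ir; have /andP[h _] : nth 0 e 0 < mid 0 < nth 0 e 1 by exact: mid_lt.
by apply: (lt_le_trans h); apply: mid_homo; rewrite ir.
Qed.

Let Z_mid i : (i < r)%N -> (Z (mid i.+1) < Z (mid i))%N.
Proof.
move=> ir; have lt := Y_mid ir; have [h _] := exchange_rate lt.
have : ((Y (mid i.+1))%:R : R) < (Y (mid i))%:R by rewrite ltr_nat.
have := @mid_gt0 i (ltnW ir); rewrite -(ltr_nat R); nra.
Qed.

Let slopes i : (i < r)%N ->
  mid i * (y i)%:R < (z i)%:R /\ (z i)%:R <= mid i.+1 * (y i)%:R.
Proof.
move=> ir; have lt := Y_mid ir; have := exchange_rate lt.
by rewrite /y /z (natrB _ (ltnW lt)) (natrB _ (ltnW (Z_mid ir))).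
Qed.

(** Equal vectors would have equal slopes, but these lie in the disjoint
   intervals from [mid i] (excluded) to [mid (i + 1)]. *)
Let pair_inj i j : (i < j)%N -> (j < r)%N -> (y i, z i) <> (y j, z j).
Proof.
move=> ij jr [ey ez].
have [_ h1] := slopes (ltn_trans ij jr).
have [h2 _] := slopes jr.
have : mid i.+1 <= mid j by apply: mid_homo; rewrite ij ltnW.
rewrite ey ez in h1; have := ler0n R (y j); nra.
Qed.

Let telescope (F : nat -> nat) k :
  (forall i, (i < k)%N -> (F i.+1 < F i)%N) ->
  (\sum_(i < k) (F i - F i.+1) + F k = F 0)%N.
Proof.
elim: k => [|k IH] dec; first by rewrite big_ord0.
rewrite big_ord_recr /= -(IH (fun i ik => dec i (ltnW ik))) -addnA.
by rewrite subnK // ltnW // dec.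
Qed.

Variables (s : seq step) (j : nat).
Hypotheses (ps : paths_to m n s) (diag_s : diagonals s = n)
  (match_s : (n <= matches w s + j)%N).

Let gaps_s : (gaps s + n = m)%N.
Proof. by have := gaps_diagonals ps; rewrite diag_s; lia. Qed.

Let gaps_min b : (gaps s <= Y b)%N.
Proof.
have := gaps_diagonals (opt_path b); have := diagonals_le (opt_path b).
by rewrite -/(Y b); have := gaps_s; lia.
Qed.

Let Z_low : (n <= Z (mid r) + j)%N.
Proof.
apply: (leq_trans match_s); rewrite leq_add2r -(ler_nat R).
have [[_ /(_ _ ps) + _]] := optP (mid r); rewrite /score -/(Y _) -/(Z _).
have : ((gaps s)%:R : R) <= (Y (mid r))%:R by rewrite ler_nat gaps_min.
have := @mid_gt0 r (leqnn r); nra.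
Qed.

Let Z_le b : (Z b <= diagonals (opt b))%N.
Proof. exact: matches_from_le. Qed.

Let sum_z : (\sum_(i < r) z i <= j)%N.
Proof.
have := @telescope (fun i => Z (mid i)) r Z_mid; rewrite -/z.
have := Z_low; have := Z_le (mid 0); have := diagonals_le (opt_path (mid 0)).
by rewrite /z; lia.
Qed.

Let sum_y : (\sum_(i < r) y i <= 2 * j)%N.
Proof.
have := @telescope (fun i => Y (mid i)) r Y_mid.
have := @telescope (fun i => Z (mid i)) r Z_mid.
have := Z_low; have := Z_le (mid 0); have := gaps_diagonals (opt_path (mid 0)).
have := gaps_min (mid r); have := gaps_s; rewrite -/(Y (mid 0)) /y.
by lia.
Qed.

Let z_gt0 i : (i < r)%N -> (0 < z i)%N.
Proof. by move=> /Z_mid; rewrite /z; lia. Qed.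

Let y_gt0 i : (i < r)%N -> (0 < y i)%N.
Proof. by move=> /Y_mid; rewrite /y; lia. Qed.

(** Every critical penalty trades away at least one match.  The optimal paths
start with at most [n] matches and never fall below the matches of [s], which
has the fewest gaps possible. *)
Lemma num_critical_le : (num_critical R w m n <= j)%N.
Proof.
apply: leq_trans sum_z; rewrite -[leqLHS]/r -{1}(card_ord r) -sum1_card.
by apply: leq_sum => i _; exact: z_gt0.
Qed.

(** The matches lost per gap saved are different at different critical
penalties, so the integer vectors (gaps saved, matches lost) are pairwise
distinct.  At most [K ^ 2] of them have both entries at most [K]; each of the
others has sum larger than [K], while all the sums add up to at most
[3 * j]. *)
Lemma num_critical_cube K :
  (K * num_critical R w m n <= K ^ 3 + 3 * j)%N.
Proof.
rewrite -[num_critical _ _ _ _]/r.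
pose small := [pred i : 'I_r | (y i <= K)%N && (z i <= K)%N].
have card_small : (#|small| <= K ^ 2)%N.
  pose f (i : 'I_r) : 'I_K.+1 * 'I_K.+1 := (inord (y i), inord (z i)).
  have f_inj : {in small &, injective f}.
    move=> i i'; rewrite !inE => /andP[yK zK] /andP[yK' zK'] /= [].
    move=> /(congr1 val); rewrite /= !inordK ?ltnS// => ey.
    move=> /(congr1 val); rewrite /= !inordK ?ltnS// => ez.
    apply/val_inj => /=; have [lt|lt|//] := ltngtP i i'.
      by case: (pair_inj lt (ltn_ord i')); rewrite ey ez.
    by case: (pair_inj lt (ltn_ord i)); rewrite ey ez.
  rewrite -(card_in_imset f_inj).
  have sub : f @: small \subset finset.setX [set~ ord0]%SET [set~ ord0]%SET.
    apply/fintype.subsetP => u /imsetP[i]; rewrite !inE => /andP[yK zK] -> /=.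
    rewrite -!val_eqE /= !inordK ?ltnS// -!lt0n.
    by rewrite y_gt0 // z_gt0.
  by rewrite (leq_trans (subset_leq_card sub))// cardsX !cardsC1 card_ord.
have big_sum : (K * #|[predC small]| <= 3 * j)%N.
  apply: (@leq_trans (\sum_(i < r) y i + \sum_(i < r) z i)%N); last first.
    by have := sum_y; have := sum_z; lia.
  rewrite -big_split /= mulnC -sum_nat_const.
  rewrite [leqRHS](bigID (mem [predC small])) /=.
  apply: leq_trans (leq_addr _ _); apply: leq_sum => i.
  by rewrite !inE negb_and -!ltnNge; lia.
have : (#|small| + #|[predC small]| = r)%N by rewrite cardC card_ord.
move=> <-; rewrite mulnDr leq_add//.
by rewrite expnS leq_mul2l card_small orbT.
Qed.

End CountingRegions.

(** * Lines searching for paths with few mismatches *)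

(** The condition on the heights excludes the steps [StepE2]: such a path
rises by one row with each diagonal step, and its gaps are forced by its end
points. *)
Definition chain (w : nat * nat -> bool) (a b : nat * nat) (j : nat) : Prop :=
  exists s, [/\ foldl move a s = b, (a.2 + diagonals s = b.2)%N &
                (diagonals s <= matches_from w a s + j)%N].

Section Chains.
Variable w : nat * nat -> bool.

Lemma chain_refl a : chain w a a 0.
Proof. by exists [::]; rewrite /= addn0. Qed.

Lemma chain_weaken a b j j' : (j <= j')%N -> chain w a b j -> chain w a b j'.
Proof.
move=> jj [s [h1 h2 h3]]; exists s; split=> //.
by apply: leq_trans h3 _; rewrite leq_add2l.
Qed.

Lemma chain_trans a b c j j' :
  chain w a b j -> chain w b c j' -> chain w a c (j + j').
Proof.
move=> [s [h1 h2 h3]] [s' [h1' h2' h3']]; exists (s ++ s').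
have matches_cat : (matches_from w a (s ++ s') =
    matches_from w a s + matches_from w b s')%N.
  rewrite -h1; elim: s a {h1 h2 h3} => [|e s IH] a //=.
  by rewrite IH addnA.
split; first by rewrite foldl_cat h1.
  by rewrite /diagonals count_cat addnA [(a.2 + _)%N]h2 -h2'.
by rewrite matches_cat /diagonals count_cat; move: h3 h3'; rewrite /diagonals; lia.
Qed.

Lemma chain_right u r k : chain w (u, r) ((u + k)%N, r) 0.
Proof.
exists (nseq k StepE1); split.
- by elim: k u => [|k IH] u /=; rewrite ?addn0// IH addSnnS.
- by rewrite /diagonals count_nseq addn0.
- by rewrite /diagonals count_nseq.
Qed.

Lemma chain_diag u r : chain w (u, r) (u.+1, r.+1) (~~ w (u.+1, r.+1)).
Proof.
by exists [:: StepE12]; split; rewrite /diagonals /= ?addn1//; case: (w _).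
Qed.

Lemma chain_diags u r k : chain w (u, r) ((u + k)%N, (r + k)%N) k.
Proof.
elim: k u r => [|k IH] u r; first by rewrite !addn0; exact: chain_refl.
rewrite -[X in chain _ _ _ X]add1n -!addSnnS; apply: chain_trans (IH _ _).
by apply: chain_weaken (chain_diag u r); case: (w _).
Qed.

Lemma chain_path m n u j : (u <= m)%N -> chain w (0, 0)%N (u, n) j ->
  exists s, [/\ paths_to m n s, diagonals s = n & (n <= matches w s + j)%N].
Proof.
move=> um cj; have := chain_trans cj (chain_right u n (m - u)).
rewrite subnKC// addn0 => -[s [h1 h2 h3]]; exists s.
by split=> //; move: h2; rewrite /= add0n // => <-.
Qed.

End Chains.

(** A line searches a row of trials for a match, and its room is the number of
trials that remain to its right.  Failure and a success in the last trial both
give 0, so that room 0 stands for death. *)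
Fixpoint next_room (s : seq bool) : nat :=
  if s is b :: s' then (if b then size s' else next_room s') else 0%N.

(** Several lines search the same row of trials.  They are listed by decreasing
room, the first one having spent the most mismatches: line [i] may, instead of
searching, step diagonally from the old position of line [i + 1] at the cost
of one more mismatch. *)
Fixpoint update (s : seq bool) (rooms : seq nat) : seq nat :=
  if rooms is r :: rest then
    maxn (next_room (drop (size s - r) s)) (head 0%N rest).-1 :: update s rest
  else [::].

Definition run (rows : seq (seq bool)) (rooms : seq nat) : seq nat :=
  foldl (fun rms s => update s rms) rooms rows.

Definition row_bits (w : nat * nat -> bool) (a : nat * nat) (M : nat) :=
  [seq w ((a.1 + i)%N, a.2.+1) | i <- iota 1 M].

Fixpoint bits (w : nat * nat -> bool) (a : nat * nat) (M n : nat) :=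
  if n is n'.+1 then row_bits w a M :: bits w (a.1, a.2.+1) M n' else [::].

Lemma next_room_le s : (next_room s <= (size s).-1)%N.
Proof.
elim: s => [|b s IH] //=; case: b => //.
by apply: leq_trans IH (leq_pred _).
Qed.

Lemma next_room_drop k s : (next_room (drop k s) <= next_room s)%N.
Proof.
elim: s k => [|b s IH] [|k] //=.
case: b; last exact: IH.
apply: leq_trans (next_room_le _) _; rewrite size_drop.
by lia.
Qed.

Lemma size_update s rooms : size (update s rooms) = size rooms.
Proof. by elim: rooms => //= r rest ->. Qed.

Lemma update_le s rooms : all (fun r => r <= size s)%N rooms ->
  all (fun r => r <= size s)%N (update s rooms).
Proof.
elim: rooms => //= r rest IH /andP[rM restM]; rewrite IH// andbT geq_max.
rewrite (leq_trans (next_room_drop _ _)) ?(leq_trans (next_room_le _)) ?leq_pred//=.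
by case: rest restM {IH} => //= r2 ? /andP[+ _]; lia.
Qed.

Lemma update_sorted s rooms : sorted geq rooms -> sorted geq (update s rooms).
Proof.
elim: rooms => //= r [|r2 rest] IH //= /andP[rr2 srt].
move: (IH srt) => /= ->; rewrite andbT /= geq_max; apply/andP; split.
  rewrite leq_max; apply/orP; left.
  have -> : drop (size s - r2) s = drop (size s - r2 - (size s - r)) (drop (size s - r) s).
    by rewrite drop_drop subnK//; move: rr2 => /=; lia.
  exact: next_room_drop.
rewrite leq_max; apply/orP; right.
by case: rest srt {IH} => //= r3 rest /andP[/= + _]; lia.
Qed.

Lemma next_room_chain w u r M : (0 < next_room (row_bits w (u, r) M))%N ->
  chain w (u, r) ((u + (M - next_room (row_bits w (u, r) M)))%N, r.+1) 0.
Proof.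
rewrite /row_bits /=.
have -> : [seq w ((u + i)%N, r.+1) | i <- iota 1 M] =
    [seq w (i, r.+1) | i <- iota u.+1 M].
  rewrite -[u.+1]addn1 iotaDl -map_comp; exact: eq_map.
elim: M u => [|M IH] u //=.
case: ifPn => [wu|wu] pos.
  rewrite size_map size_iota subSn// subnn addn1.
  by apply: chain_weaken (chain_diag w u r); rewrite wu.
have le : (next_room [seq w (i, r.+1) | i <- iota u.+2 M] <= M)%N.
  by apply: leq_trans (next_room_le _) _; rewrite size_map size_iota leq_pred.
have right : chain w (u, r) (u.+1, r) 0 by have := chain_right w u r 1; rewrite addn1.
by have := chain_trans right (IH _ pos); rewrite subSn// addnS addSn.
Qed.

Lemma size_row_bits w a M : size (row_bits w a M) = M.
Proof. by rewrite /row_bits size_map size_iota. Qed.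

Lemma drop_row_bits w u r M k :
  drop k (row_bits w (u, r) M) = row_bits w ((u + k)%N, r) (M - k).
Proof.
rewrite /row_bits /= -map_drop drop_iota addnC iotaDl -map_comp.
by apply: eq_map => i /=; rewrite addnA.
Qed.

(** A living line of room [r] stands in column [b.1 + (M - r)] of row [b.2],
and line [i] of [k] lines has spent at most [k - 1 - i] mismatches. *)
Definition tracked w a b M (rooms : seq nat) :=
  forall i, (0 < nth 0 rooms i)%N ->
    chain w a ((b.1 + (M - nth 0 rooms i))%N, b.2) (size rooms - i.+1).

Lemma tracked_update w a b M rooms : all (fun r => r <= M)%N rooms ->
  tracked w a b M rooms ->
  tracked w a (b.1, b.2.+1) M (update (row_bits w b M) rooms).
Proof.
case: b => u r /= roomsM tr i; rewrite size_update.
have [ik|ki] := ltnP i (size rooms); last first.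
  by rewrite nth_default ?size_update.
have step : (nth 0 (update (row_bits w (u, r) M) rooms) i =
    maxn (next_room (drop (M - nth 0 rooms i) (row_bits w (u, r) M)))
      (nth 0 rooms i.+1).-1)%N.
  elim: rooms i ik {roomsM tr} => //= r1 rest IH [|i] /=.
    by rewrite size_row_bits; case: rest {IH}.
  by rewrite ltnS => /IH ->.
have leM j : (nth 0 rooms j <= M)%N.
  have [jk|kj] := ltnP j (size rooms); last by rewrite nth_default.
  exact: (allP roomsM _ (mem_nth 0 jk)).
rewrite step; case: (leqP (next_room _) (nth 0%N rooms i.+1).-1) => _ pos.
  have pos1 : (0 < nth 0 rooms i.+1)%N by lia.
  have ik1 : (i.+1 < size rooms)%N.
    by rewrite ltnNge; apply/negP => le; move: pos1; rewrite nth_default.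
  have := chain_trans (tr _ pos1) (chain_diags w _ r 1); rewrite /= !addn1.
  have -> : (size rooms - i.+2).+1 = (size rooms - i.+1)%N by lia.
  suff -> : ((u + (M - nth 0 rooms i.+1)).+1 =
    u + (M - (nth 0 rooms i.+1).-1))%N by [].
  by have := leM i.+1; lia.
have pos0 : (0 < nth 0 rooms i)%N.
  rewrite lt0n; apply: contraTneq pos => ->; rewrite subn0 drop_oversize//.
  by rewrite size_row_bits.
move: pos; rewrite drop_row_bits subKn// => pos.
have := chain_trans (tr _ pos0) (next_room_chain pos); rewrite addn0 /=.
set x := next_room _.
have xle : (x <= nth 0 rooms i)%N.
  by apply: leq_trans (next_room_le _) _; rewrite size_row_bits leq_pred.
suff <- : (u + (M - nth 0 rooms i) + (nth 0 rooms i - x) = u + (M - x))%N by [].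
by have := leM i; lia.
Qed.

Lemma run_invariants (M : nat) (rows : seq (seq bool)) (rooms : seq nat) :
  all (fun row => size row == M) rows ->
  all (fun r => r <= M)%N rooms -> sorted geq rooms ->
  all (fun r => r <= M)%N (run rows rooms) /\ sorted geq (run rows rooms).
Proof.
elim: rows rooms => //= row rows IH rooms /andP[/eqP sz rowsM] le srt.
apply: IH => //; last exact: update_sorted.
by rewrite -sz; apply: update_le; rewrite sz.
Qed.

(** If the line with the most mismatches survives [n] rows of [m + 1] trials,
then it has crossed them within [m] columns: the last trial only serves as the
place of death. *)
Lemma run_chain w a m n k :
  (0 < head 0 (run (bits w a m.+1 n) (nseq k m.+1)))%N ->
  chain w a ((a.1 + m)%N, (a.2 + n)%N) k.-1.
Proof.
have gen rooms b : all (fun r => r <= m.+1)%N rooms -> b.1 = a.1 ->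
    tracked w a b m.+1 rooms ->
    tracked w a (a.1, (b.2 + n)%N) m.+1 (run (bits w b m.+1 n) rooms) /\
    size (run (bits w b m.+1 n) rooms) = size rooms.
  elim: n rooms b => [|n IH] rooms b le ba tr.
    by rewrite addn0 -ba; case: b ba tr.
  rewrite -addSnnS -(size_update (row_bits w b m.+1) rooms).
  apply: (IH _ (b.1, b.2.+1)) => //=; last exact: tracked_update.
  by have := @update_le (row_bits w b m.+1) rooms; rewrite size_row_bits; exact.
have le : all (fun r => r <= m.+1)%N (nseq k m.+1).
  by apply/allP => r /nseqP[-> _].
have tr0 : tracked w a a m.+1 (nseq k m.+1).
  move=> i pos; have ik : (i < k)%N.
    by rewrite ltnNge; apply/negP => ?; move: pos; rewrite nth_default ?size_nseq.
  rewrite nth_nseq ik subnn addn0; apply: chain_weaken (leq0n _) _.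
  by rewrite -surjective_pairing; exact: chain_refl.
have [tr szr] := gen _ a le erefl tr0; rewrite -nth0 => pos.
have := tr 0%N pos; rewrite szr size_nseq /= subn1 => c1.
set x := nth _ _ _ in pos c1.
(* the truncated differences make the columns add up to [m] even without the
   bound [x <= m + 1] *)
have := chain_trans c1 (chain_right w _ _ (x - (1 + (x - m.+1)))).
rewrite addn0 -addnA.
suff -> : (m.+1 - x + (x - (1 + (x - m.+1))) = m)%N by [].
by lia.
Qed.

(** * Expectations over tables of Bernoulli trials *)

(** Monotonicity is needed on a domain only, because tables of trials are
represented by lists of a prescribed size. *)
Definition mono_on (R : realType) (T : Type) (D : pred T) (E : (T -> R) -> R) :=
  forall f g, (forall x, D x -> f x <= g x) -> E f <= E g.

Section FiniteExpectations.
Variables (R : realType) (T : Type).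
Implicit Types (E : (T -> R) -> R) (D : pred T).

(** With [E] the expectation operator of one sample, this is the one of [n]
independent samples; applied to itself it handles rows, tables and lists of
tables alike. *)
Fixpoint iterE E (n : nat) (F : seq T -> R) : R :=
  if n is n'.+1 then E (fun x => iterE E n' (fun s => F (x :: s))) else F [::].

Definition linear_mean E := [/\ forall a, E (fun=> a) = a,
  forall a f, E (fun x => a * f x) = a * E f &
  forall f g, E (fun x => f x + g x) = E f + E g].

Lemma iterE_mono D E n : mono_on D E ->
  mono_on (fun s => (size s == n) && all D s) (iterE E n).
Proof.
move=> mE; elim: n => [|n IH] f g fg /=; first exact: fg.
apply: mE => x Dx; apply: IH => s /andP[/eqP sn Ds].
by apply: fg; rewrite /= sn eqxx Dx.
Qed.

Lemma eq_iterE E n F G : (forall s, size s = n -> F s = G s) ->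
  iterE E n F = iterE E n G.
Proof.
elim: n F G => [|n IH] F G FG /=; first exact: FG.
by congr E; apply/funext => x; apply: IH => s sn; rewrite FG//= sn.
Qed.

Lemma iterE_scale E n a f : linear_mean E ->
  iterE E n (fun x => a * f x) = a * iterE E n f.
Proof.
move=> [_ Es _]; elim: n f => [|n IH] f //=.
rewrite -Es; congr E; apply/funext => x; exact: IH.
Qed.

Lemma iterE_linear E n : linear_mean E ->
  [/\ forall a, iterE E n (fun=> a) = a,
  forall a f, iterE E n (fun x => a * f x) = a * iterE E n f &
  forall f g, iterE E n (fun x => f x + g x) = iterE E n f + iterE E n g].
Proof.
move=> lE; have [Ec Es Ea] := lE; split=> [a|a f|]; last 1 first.
- elim: n => [|n IH] f g //=; rewrite -Ea; congr E; apply/funext => x; exact: IH.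
- by elim: n => //= n IH; rewrite -[RHS]Ec; congr E; apply/funext => x; exact: IH.
- exact: iterE_scale.
Qed.

Lemma iterE_cat E k n F :
  iterE E (k + n) F = iterE E k (fun s => iterE E n (fun s' => F (s ++ s'))).
Proof.
elim: k F => [|k IH] F //=; congr E; apply/funext => x; exact: IH.
Qed.

Lemma iterE_prod E n (g : T -> R) : linear_mean E ->
  iterE E n (fun s => \prod_(x <- s) g x) = E g ^+ n.
Proof.
move=> lE; have [Ec Es _] := lE; elim: n => [|n IH] /=; first by rewrite big_nil.
rewrite exprSr -IH -Es; congr E; apply/funext => x.
rewrite mulrC -iterE_scale//; congr iterE; apply/funext => s.
by rewrite big_cons.
Qed.

Lemma mean_sum E (I : Type) (r : seq I) (f : I -> T -> R) : linear_mean E ->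
  E (fun x => \sum_(i <- r) f i x) = \sum_(i <- r) E (f i).
Proof.
move=> [Ec _ Ea]; elim: r => [|i r IH].
  by rewrite big_nil -[RHS]Ec; congr E; apply/funext => x; rewrite big_nil.
rewrite big_cons -IH -Ea; congr E; apply/funext => x; by rewrite big_cons.
Qed.

End FiniteExpectations.

Lemma iterE_iterE (R : realType) (T : Type) (E : (T -> R) -> R) n M
    (F : seq (seq T) -> R) :
  iterE (iterE E M) n F = iterE E (n * M) (fun s => F (reshape (nseq n M) s)).
Proof.
elim: n F => [|n IH] F //=; rewrite mulSn iterE_cat; apply: eq_iterE => s sM.
rewrite IH; apply: eq_iterE => s' _ /=; congr (F (_ :: reshape _ _)).
- by rewrite take_size_cat.
- by rewrite drop_size_cat.
Qed.

Section BernoulliTrials.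
Variables (R : realType) (p : R).
Hypothesis p01 : 0 < p < 1.

Definition bern (f : bool -> R) : R := p * f true + (1 - p) * f false.

Lemma bern_mono (D : pred bool) : (forall b, D b) -> mono_on D bern.
Proof.
move=> DT f g fg; case/andP: p01 => p0 p1.
by rewrite /bern lerD// ler_wpM2l ?fg// ?subr_ge0 ltW.
Qed.

Lemma bern_linear : linear_mean bern.
Proof.
by split=> [a|a f|f g]; rewrite /bern; ring.
Qed.

Lemma row_mono M : mono_on (fun s : seq bool => size s == M) (iterE bern M).
Proof.
move=> f g fg; apply: (@iterE_mono _ _ predT) => [|s /andP[/fg]//].
exact: bern_mono.
Qed.

Lemma row_linear M : linear_mean (iterE bern M).
Proof. exact/iterE_linear/bern_linear. Qed.

Lemma grid_mono M n : mono_on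
  (fun s : seq (seq bool) => (size s == n) && all (fun r => size r == M) s)
  (iterE (iterE bern M) n).
Proof. exact/iterE_mono/row_mono. Qed.

Lemma grid_linear M n : linear_mean (iterE (iterE bern M) n).
Proof. exact/iterE_linear/row_linear. Qed.

(** The probability that a single line of room [r] dies within [n] rows, which
for positive [r] is the probability of fewer than [n] successes in [r - 1]
trials.  The recursion reveals one trial. *)
Fixpoint death (r n : nat) : R :=
  if r is r'.+1 then
    if n is n'.+1 then p * death r' n' + (1 - p) * death r' n else 0
  else 1.

Lemma death_ge0 r n : 0 <= death r n.
Proof.
elim: r n => [|r IH] [|n] //=; case/andP: p01 => p0 p1.
by rewrite addr_ge0// mulr_ge0 ?IH// ?subr_ge0 ltW.
Qed.

Lemma death_nondecreasing r n : death r n <= death r n.+1.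
Proof.
elim: r n => [|r IH] [|n] //=; case/andP: p01 => p0 p1.
  by have := death_ge0 r 0; have := death_ge0 r 1; nra.
by have := IH n; have := IH n.+1; nra.
Qed.

(** In each row the lines search disjoint sets of trials, because a line never
needs to go beyond the old position of the next one, where the diagonal step is
available; and that alternative only increases the room.  The induction reveals
the trials one by one from the left. *)
Lemma mean_update_le M n rooms : all (fun r => r <= M)%N rooms ->
  sorted geq rooms ->
  iterE bern M (fun s => \prod_(r <- update s rooms) death r n) <=
  \prod_(r <- rooms) death r n.+1.
Proof.
elim: M rooms => [|M IHM] rooms.
  move=> le0 _ /=; rewrite (_ : \prod_(r <- update _ _) _ = 1); last first.
    elim: rooms le0 => [|r rest IH] /=; first by rewrite big_nil.
    move=> /andP[_ le0]; rewrite big_cons {}IH// mulr1.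
    by case: rest le0 => //= r2 rest /andP[]; rewrite leqn0 => /eqP ->.
  elim: rooms le0 => [|r rest IH] /=; first by rewrite big_nil.
  by rewrite leqn0 big_cons => /andP[/eqP -> /IH]; rewrite mul1r.
have skip rms b s : all (fun r => r <= M)%N rms -> size s = M ->
    update (b :: s) rms = update s rms.
  move=> + sM; elim: rms => //= r rest IH /andP[rM restM].
  by rewrite sM subSn//= IH.
elim: rooms => [|r rest IHr]; first by move=> _ _; have [c _ _] := row_linear M.+1;
    rewrite big_nil -[leRHS]c; apply: row_mono => s _; rewrite big_nil.
move=> /= /andP[rM restM] /= srt; have srt' := path_sorted srt.
have [rM'|rM'] := leqP r M.
(* the first trial lies to the left of all the lines *)
  have restM' : all (fun r => r <= M)%N rest.
    apply: sub_all (order_path_min _ srt) => [x /=|x y z /=]; lia.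
  have le' : all (fun r => r <= M)%N (r :: rest) by rewrite /= rM'.
  apply: le_trans (IHM _ le' srt); rewrite le_eqVlt; apply/orP; left; apply/eqP.
  have [Bc _ _] := bern_linear; rewrite -[RHS]Bc /=.
  congr bern; apply/funext => b; apply: eq_iterE => s sM.
  by have /= -> := skip (r :: rest) b s le' sM.
have {rM rM'} rE : r = M.+1 by lia.
subst r.
rewrite big_cons.
have [eq2|lt2] := eqVneq (head 0%N rest) M.+1.
(* the first two lines stand at the same place, and the diagonal step beats any
   search *)
  have step s : size s = M.+1 -> \prod_(r0 <- update s (M.+1 :: rest)) death r0 n =
      death M n * \prod_(r0 <- update s rest) death r0 n.
    move=> sM; rewrite /= big_cons eq2 /= (maxn_idPr _)//.
    by apply: leq_trans (next_room_drop _ _) _; rewrite (leq_trans (next_room_le _))// sM.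
  rewrite -/(iterE bern M.+1 (fun s => \prod_(r0 <- update s (M.+1 :: rest)) death r0 n)).
  rewrite (eq_iterE bern step).
  have [_ -> _] := row_linear M.+1; apply: ler_pM.
  - exact: death_ge0.
  - have [c0 _ _] := row_linear M.+1; rewrite -[leLHS]c0; apply: row_mono => s _.
    by apply: prodr_ge0 => i _; exact: death_ge0.
  - case/andP: p01 => p0 p1 /=; have := death_nondecreasing M n; nra.
  - exact: IHr.
(* the first trial is searched by the first line alone *)
have restM' : all (fun r => r <= M)%N rest.
  case: rest srt lt2 {IHr restM srt'} => //= r2 rest /andP[h srt] lt2.
  have r2M : (r2 <= M)%N by move: lt2 h => /=; lia.
  rewrite r2M /=; apply: sub_all (order_path_min _ srt) => [x /=|x y z /=]; lia.
have srt2 : sorted geq (M :: rest).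
  by case: rest restM' srt {IHr restM lt2 srt'} => //= r2 rest /andP[-> _] /andP[_ ->].
have le2 : all (fun r => r <= M)%N (M :: rest) by rewrite /= leqnn.
have [_ Rs _] := row_linear M.
rewrite {1}/bern.
rewrite (@eq_iterE _ _ bern M _ (fun s => death M n * \prod_(r0 <- update s rest) death r0 n)); last first.
  move=> s sM /=; rewrite big_cons skip// sM subnn /= sM (maxn_idPl _)//.
  by case: rest restM' {IHr restM lt2 srt' srt srt2 le2} => //= r2 rest /andP[+ _]; lia.
rewrite Rs [X in _ + _ * X](@eq_iterE _ _ bern M _ (fun s => \prod_(r0 <- update s (M :: rest)) death r0 n)); last first.
  by move=> s sM /=; rewrite !big_cons skip// sM !subnn /= drop0.
have h1 := IHM _ restM' srt'; have h2 := IHM _ le2 srt2.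
rewrite big_cons in h2.
case/andP: p01 => p0 p1; rewrite [leRHS]mulrDl -[p * _ * _ in leRHS]mulrA -[(1 - p) * _ * _ in leRHS]mulrA.
apply: lerD; apply: ler_wpM2l => //; rewrite ?subr_ge0; try exact: ltW.
by apply: ler_wpM2l; first exact: death_ge0.
Qed.

(** The rows are independent, so the row estimate iterates: the lines are
dominated by independent ones. *)
Lemma mean_run_le M n rooms : all (fun r => r <= M)%N rooms ->
  sorted geq rooms ->
  iterE (iterE bern M) n (fun rows => \prod_(r <- run rows rooms) death r 0) <=
  \prod_(r <- rooms) death r n.
Proof.
elim: n rooms => [|n IH] rooms le srt //=.
apply: le_trans (mean_update_le n le srt); apply: row_mono => s /eqP sM.
by apply: IH; [rewrite -{1}sM; apply: update_le; rewrite sM|exact: update_sorted].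
Qed.

(** The rooms decrease along the list, so the death of the first line is that
of all [k] lines. *)
Definition dead M k (rows : seq (seq bool)) : bool :=
  head 0%N (run rows (nseq k M)) == 0%N.

Lemma dead_le M n k :
  iterE (iterE bern M) n (fun rows => (dead M k rows)%:R) <= death M n ^+ k.
Proof.
have le : all (fun r => r <= M)%N (nseq k M) by apply/allP => r /nseqP[->].
have srt : sorted geq (nseq k M) by elim: k {le} => //= -[|k] //= IH; rewrite leqnn.
have := mean_run_le n le srt; rewrite big_nseq iter_mulr_1 => h.
apply: le_trans h; apply: grid_mono => rows /andP[_ rowsM].
have [_] := run_invariants rowsM le srt.
rewrite /dead; case: eqP => [|_ _]; last first.
  by apply: prodr_ge0 => i _; exact: death_ge0.
move: (run _ _) => [|r rest] /=; first by rewrite big_nil.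
move=> -> srt0; rewrite (_ : \prod_(j <- _) _ = 1)// big_cons mul1r.
have : all (fun r => r <= 0)%N rest.
  by apply: sub_all (order_path_min _ srt0) => [x /=|x y z /=]; lia.
elim: rest {srt0} => [|r0 rest IH] /=; first by rewrite big_nil.
by rewrite leqn0 big_cons => /andP[/eqP -> /IH ->]; rewrite mul1r.
Qed.

End BernoulliTrials.

(** * Finite tables in the random environment *)

Section Environment.
Variables (R : realType) (p : R) (d : measure_display) (T : measurableType d)
  (P : probability T R) (omega : nat * nat -> {RV P >-> bool}).
Hypotheses (p01 : 0 < p < 1) (iid : iid_bernoulli p omega).

Let pmf (b : bool) : R := if b then p else 1 - p.

Let sample (vs : seq (nat * nat)) (t : T) : seq bool := [seq omega v t | v <- vs].

Let measurable_site v b : measurable [set t | omega v t = b].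
Proof.
by rewrite -[X in measurable X]setTI; apply: (measurable_funPT (omega v) measurableT [set b]).
Qed.

Let measurable_sample vs (F : seq bool -> Prop) :
  measurable [set t | F (sample vs t)].
Proof.
elim: vs F => [|v vs IH] F /=.
  have [h|h] := pselect (F [::]).
    by rewrite (_ : [set t | _] = setT)//; apply/seteqP; split.
  by rewrite (_ : [set t | _] = set0)//; apply/seteqP; split.
rewrite (_ : [set t | _] =
  ([set t | omega v t = true] `&` [set t | F (true :: sample vs t)]) `|`
  ([set t | omega v t = false] `&` [set t | F (false :: sample vs t)])).
  apply: measurableU; apply: measurableI; first exact: measurable_site.
  - exact: (IH (fun s => F (true :: s))).
  - exact: measurable_site.
  - exact: (IH (fun s => F (false :: s))).
apply/seteqP; split => t /=; rewrite /sample.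
  by case: (omega v t) => h; [left|right].
by move=> [[-> //]|[-> //]].
Qed.

Let cylinder (us : seq (nat * nat)) (b : nat * nat -> bool) : set T :=
  [set t | forall v, v \in us -> omega v t = b v].

Let measurable_cylinder us b : measurable (cylinder us b).
Proof.
elim: us => [|u us IH].
  by rewrite (_ : cylinder _ _ = setT)//; apply/seteqP; split.
rewrite (_ : cylinder _ _ = [set t | omega u t = b u] `&` cylinder us b).
  by apply: measurableI => //; exact: measurable_site.
apply/seteqP; split => t /=.
  move=> h; split; first by apply: h; rewrite inE eqxx.
  by move=> v vus; apply: h; rewrite inE vus orbT.
by move=> [h1 h2] v; rewrite inE => /predU1P[->//|/h2].
Qed.

Let prob_site v b : sites v -> P [set t | omega v t = b] = (pmf b)%:E.
Proof.
move=> sv; have [law _] := iid; have := law v sv [set b].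
rewrite /distribution /pushforward /= /bernoulli_prob.
have -> : 0 <= p <= 1 by case/andP: p01 => /ltW -> /ltW ->.
by rewrite fsbig_set1 => <-.
Qed.

Let prob_cylinder us b : uniq us -> (forall v, v \in us -> sites v) ->
  P (cylinder us b) = (\prod_(v <- us) pmf (b v))%:E.
Proof.
move=> uus sus; have [_ ind] := iid.
pose B v := [set b v].
have /= := ind [fset v in us]%fset B.
have sub : [set` [fset v in us]%fset] `<=` sites.
  by move=> v /=; rewrite inE; exact: sus.
move=> /(_ sub (fun=> I)).
have -> : \bigcap_(v in [set` [fset v in us]%fset]) omega v @^-1` B v = cylinder us b.
  apply/seteqP; split => t /= h v vus; first by apply: h; rewrite /= inE.
  by apply: h; move: vus; rewrite /= inE.
rewrite (perm_big us) /=; last first.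
  by apply: uniq_perm => [|//|v]; [exact: fset_uniq|rewrite inE].
move=> ->; rewrite -prodEFin; apply: eq_big_seq => v vus.
exact/prob_site/sus.
Qed.

(** Revealing one more site splits the cylinder of the sites already seen in
   two; this makes independence usable one site at a time. *)
Let prob_cylinder_sample us vs b (F : pred (seq bool)) : uniq (us ++ vs) ->
  (forall v, v \in us ++ vs -> sites v) ->
  P (cylinder us b `&` [set t | F (sample vs t)]) =
  (\prod_(v <- us) pmf (b v) * iterE (bern p) (size vs) (fun s => (F s)%:R))%:E.
Proof.
elim: vs us b F => [|v vs IH] us b F; rewrite ?cats0 => uus sus /=.
  rewrite /sample /=; case: (F [::]); rewrite ?mulr1 ?mulr0.
    rewrite (_ : [set _ | true] = setT) ?setIT; first exact: prob_cylinder.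
    by apply/seteqP; split.
  by rewrite (_ : [set _ | false] = set0) ?setI0 ?measure0//; apply/seteqP; split.
have uus' : uniq ((v :: us) ++ vs).
  by move: uus; rewrite -cat1s uniq_catCA.
have vus : v \notin us by move: uus' => /= /andP[]; rewrite mem_cat negb_or => /andP[].
have sus' u : u \in (v :: us) ++ vs -> sites u.
  move=> h; apply: sus; move: h; rewrite !(inE, mem_cat).
  by case/orP => [/orP[]|] ->; rewrite ?orbT.
pose b' c u := if u == v then c else b u.
have cylE c : cylinder (v :: us) (b' c) = cylinder us b `&` [set t | omega v t = c].
  apply/seteqP; split => t /=.
    move=> h; split => [u uus0|].
      have := h u; rewrite inE uus0 orbT => ->//; rewrite /b'.
      by case: eqP => // uv; move: vus; rewrite -uv uus0.
    by rewrite h ?inE ?eqxx// /b' eqxx.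
  move=> [h1 h2] u; rewrite inE /b'; case: eqP => [->//|_ /= uus0].
  exact: h1.
have prodE c : \prod_(u <- v :: us) pmf (b' c u) = pmf c * \prod_(u <- us) pmf (b u).
  rewrite big_cons /b' eqxx; congr (_ * _); apply: eq_big_seq => u uus0.
  by case: eqP => // uv; move: vus; rewrite -uv uus0.
rewrite (_ : _ `&` _ =
  (cylinder (v :: us) (b' true) `&` [set t | F (true :: sample vs t)]) `|`
  (cylinder (v :: us) (b' false) `&` [set t | F (false :: sample vs t)])).
  rewrite measureU.
  - have IHc c := IH _ (b' c) (fun s => F (c :: s)) uus' sus'.
    apply: etrans (congr2 _ (IHc true) (IHc false)) _.
    by rewrite !prodE -EFinD /bern /pmf; congr (_%:E); ring.
  - apply: measurableI; first exact: measurable_cylinder.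
    exact: (measurable_sample vs (fun s => F (true :: s))).
  - apply: measurableI; first exact: measurable_cylinder.
    exact: (measurable_sample vs (fun s => F (false :: s))).
  - by apply/seteqP; split => t //= [[]]; rewrite !cylE /= => -[_ ->] _ [[]].
rewrite !cylE; apply/seteqP; split => t /=; rewrite /sample.
  by case: (omega v t) => -[h1 h2]; [left|right].
by move=> [[[h1 ->] h2]|[[h1 ->] h2]].
Qed.

(** Events that depend on finitely many sites have the probability computed by
averaging over Bernoulli trials. *)
Lemma prob_sample vs (F : pred (seq bool)) : uniq vs ->
  (forall v, v \in vs -> sites v) ->
  P [set t | F [seq omega v t | v <- vs]] =
  (iterE (bern p) (size vs) (fun s => (F s)%:R))%:E.
Proof.
move=> uvs svs; have := @prob_cylinder_sample [::] vs xpredT F uvs svs.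
rewrite big_nil mul1r => <-; congr (P _); apply/seteqP; split => t //=.
by move=> [].
Qed.

Lemma measurable_sampled vs (F : seq bool -> Prop) :
  measurable [set t | F [seq omega v t | v <- vs]].
Proof. exact: measurable_sample. Qed.

End Environment.

(** * The tail of the number of critical penalties *)

Lemma foldl_move_le v s : (v.1 <= (foldl move v s).1)%N /\ (v.2 <= (foldl move v s).2)%N.
Proof.
elim: s v => [|e s IH] v //=; have [] := IH (move v e).
by case: e => /=; lia.
Qed.

Lemma eq_matches w w' m n s : paths_to m n s ->
  (forall i j, (0 < i <= m)%N -> (0 < j <= n)%N -> w (i, j) = w' (i, j)) ->
  matches w s = matches w' s.
Proof.
rewrite /paths_to /matches /= => + ww; elim: s (0%N, 0%N) => [|e s IH] v //= ps.
rewrite (IH _ ps); congr (_ + _)%N; case: e ps => //= ps.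
have := foldl_move_le (v.1.+1, v.2.+1) s; rewrite ps /= => -[h1 h2].
by rewrite ww.
Qed.

(** Paths to [(m, n)] read the sites of the box only; this is what makes events
about [num_critical] measurable. *)
Lemma eq_num_critical (R : realType) w w' m n :
  (forall i j, (0 < i <= m)%N -> (0 < j <= n)%N -> w (i, j) = w' (i, j)) ->
  num_critical R w m n = num_critical R w' m n.
Proof.
move=> ww; have max_eq b : maximisers w m n b = maximisers (R := R) w' m n b.
  apply/seteqP; split=> s [ps max]; split=> // s' ps'; have := max _ ps';
  by rewrite /score (eq_matches ps ww) (eq_matches ps' ww).
have min_eq b : mingap_maximisers w m n b = mingap_maximisers (R := R) w' m n b.
  by rewrite /mingap_maximisers max_eq.
rewrite /num_critical (_ : critical_penalties w m n = critical_penalties (R := R) w' m n)//.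
rewrite /critical_penalties /different_regions.
by apply/seteqP; split=> b [b0 h]; split=> // eps /h [b1 [b2 [? ? ? ?]]];
  rewrite ?min_eq -?min_eq => ?; exists b1, b2; split; rewrite // ?min_eq // -?min_eq.
Qed.

Definition grid (a : nat * nat) (M n : nat) : seq (seq (nat * nat)) :=
  [seq [seq ((a.1 + c)%N, (a.2 + r).+1) | c <- iota 1 M] | r <- iota 0 n].

Lemma bits_grid w a M n : bits w a M n = [seq [seq w v | v <- row] | row <- grid a M n].
Proof.
elim: n a => [|n IH] a //=; rewrite {}IH /row_bits -map_comp addn0.
congr (_ :: _).
rewrite /grid /= (iotaDl 1 0 n) -!map_comp.
apply: eq_map => r /=; congr (map _ _); apply: eq_map => c.
by rewrite addSnnS.
Qed.

Lemma uniq_flatten_map (I : eqType) (T : eqType) (key : T -> I) (f : I -> seq T) (s : seq I) :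
  uniq s -> (forall i, i \in s -> uniq (f i)) ->
  (forall i v, i \in s -> v \in f i -> key v = i) ->
  uniq (flatten [seq f i | i <- s]).
Proof.
elim: s => //= i s IH /andP[i_s us] uf keyf; rewrite cat_uniq uf ?inE ?eqxx//=.
rewrite IH//; last 2 first.
  by move=> j js; apply: uf; rewrite inE js orbT.
  by move=> j v js; apply: keyf; rewrite inE js orbT.
rewrite andbT; apply/hasPn => v /flattenP[_ /mapP[j js ->] vj].
apply: contra i_s => vi.
have <- := keyf i v (mem_head _ _) vi.
by rewrite (keyf j v)// inE js orbT.
Qed.

Lemma mem_grid a M n v : v \in flatten (grid a M n) ->
  [/\ (a.1 < v.1)%N, (a.2 < v.2)%N & (v.2 <= a.2 + n)%N].
Proof.
move=> /flatten_mapP[r]; rewrite mem_iota => rn /mapP[c].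
by rewrite mem_iota => cM -> /=; split; lia.
Qed.

Lemma uniq_grid a M n : uniq (flatten (grid a M n)).
Proof.
apply: (@uniq_flatten_map _ _ (fun v : nat * nat => v.2.-1 - a.2)%N).
- exact: iota_uniq.
- move=> r _; rewrite map_inj_uniq ?iota_uniq// => c c' [].
  exact: addnI.
- by move=> r v _ /mapP[c _ ->] /=; rewrite addKn.
Qed.

Definition block_sites (mu M l i : nat) := grid ((i * mu)%N, (i * l)%N) M l.

(** Blocks of [l] rows placed along a staircase occupy disjoint rows, so their
sites are distinct even when consecutive blocks share columns. *)
Lemma uniq_blocks mu M l N : (0 < l)%N ->
  uniq (flatten [seq flatten (block_sites mu M l i) | i <- iota 0 N]).
Proof.
move=> l0; apply: (@uniq_flatten_map _ _ (fun v : nat * nat => v.2.-1 %/ l)%N).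
- exact: iota_uniq.
- by move=> i _; exact: uniq_grid.
- have quot (i y : nat) : (i * l < y)%N -> (y <= i * l + l)%N -> (y.-1 %/ l)%N = i.
    move=> h1 h2; have -> : y.-1 = (i * l + (y.-1 - i * l))%N by lia.
    by rewrite divnMDl// divn_small ?addn0//; lia.
  by move=> i v _ /mem_grid [_]; exact: quot.
Qed.

Lemma reshape_flatten (T : Type) (ss : seq (seq T)) n k :
  all (fun s => size s == k) ss -> size ss = n ->
  reshape (nseq n k) (flatten ss) = ss.
Proof.
move=> ssk <-; rewrite -[RHS]flattenK; congr reshape.
by elim: ss ssk => //= s ss IH /andP[/eqP -> /IH ->].
Qed.

Lemma size_flatten_const (T : Type) (ss : seq (seq T)) k :
  all (fun s => size s == k) ss -> size (flatten ss) = (size ss * k)%N.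
Proof.
elim: ss => //= s ss IH /andP[/eqP sk ssk].
by rewrite size_cat IH// sk.
Qed.

Lemma grid_rows a M n : all (fun row => size row == M) (grid a M n).
Proof. by apply/allP => _ /mapP[r _ ->]; rewrite size_map size_iota. Qed.

Lemma iterE_map (R : realType) (S T : Type) (E : (S -> R) -> R) (g : S -> T) n
    (F : seq T -> R) :
  iterE (fun f => E (fun x => f (g x))) n F = iterE E n (fun s => F (map g s)).
Proof.
by elim: n F => [|n IH] F //=; congr E; apply/funext => x; exact: IH.
Qed.

Section Sampling.
Variables (R : realType) (p : R) (d : measure_display) (T : measurableType d)
  (P : probability T R) (omega : nat * nat -> {RV P >-> bool}).

Lemma measurable_num_critical m n (Q : nat -> Prop) :
  measurable [set t | Q (num_critical R (fun v => omega v t) m n)].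
Proof.
pose vs := flatten (grid (0, 0)%N m n).
pose w_of (s : seq bool) v := nth false s (index v vs).
have eqn t : num_critical R (fun v => omega v t) m n =
    num_critical R (w_of [seq omega v t | v <- vs]) m n.
  apply: eq_num_critical => i j /andP[i0 im] /andP[j0 jn].
  have ij : (i, j) \in vs.
    apply/flattenP; exists [seq (c, j) | c <- iota 1 m].
      apply/mapP; exists j.-1; first by rewrite mem_iota; lia.
      by apply: eq_map => c; rewrite /= !add0n prednK.
    by apply/mapP; exists i; rewrite // mem_iota; lia.
  by rewrite /w_of (nth_map (i, j)) ?index_mem// nth_index.
under eq_set do rewrite eqn.
exact: (measurable_sampled omega vs (fun s => Q (num_critical R (w_of s) m n))).
Qed.
Hypotheses (p01 : 0 < p < 1) (iid : iid_bernoulli p omega).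

Lemma prob_blocks mu M l N (F : pred (seq (seq (seq bool)))) : (0 < l)%N ->
  let blocks t :=
    [seq bits (fun v => omega v t) ((i * mu)%N, (i * l)%N) M l | i <- iota 0 N] in
  measurable [set t | F (blocks t)] /\
  P [set t | F (blocks t)] =
  (iterE (iterE (iterE (bern p) M) l) N (fun s => (F s)%:R))%:E.
Proof.
move=> l0 blocks; pose vs := flatten [seq flatten (block_sites mu M l i) | i <- iota 0 N].
pose shapes (s : seq bool) := [seq reshape (nseq l M) x | x <- reshape (nseq N (l * M)) s].
have blocksE t : blocks t = shapes [seq omega v t | v <- vs].
  rewrite /shapes /vs map_flatten -map_comp.
  rewrite (@reshape_flatten _ _ N) ?size_map ?size_iota//; last first.
    apply/allP => s /mapP[i _ ->] /=; rewrite size_map.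
    by rewrite (size_flatten_const (grid_rows _ _ _)) size_map size_iota.
  rewrite -map_comp; apply: eq_map => i /=; rewrite map_flatten bits_grid.
  rewrite reshape_flatten ?size_map ?size_iota//.
  by apply/allP => s /mapP[_ /mapP[r _ ->] ->]; rewrite !size_map size_iota.
have eqF : [set t | F (blocks t)] = [set t | (F \o shapes) [seq omega v t | v <- vs]].
  by apply/seteqP; split => t /=; rewrite blocksE.
split; first by rewrite eqF; exact: (measurable_sampled omega vs (F \o shapes)).
rewrite eqF (prob_sample p01 iid); last 2 first.
- exact: uniq_blocks.
- move=> v /flatten_mapP[i _ /mem_grid[h1 h2 _]]; split.
    exact: leq_ltn_trans h1.
  exact: leq_ltn_trans h2.
congr (_%:E).
have -> : iterE (iterE (bern p) M) l = (fun f => iterE (bern p) (l * M)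
    (fun s => f (reshape (nseq l M) s))).
  by apply/funext => f; exact: iterE_iterE.
rewrite iterE_map iterE_iterE; congr (iterE _ _ _).
rewrite (@size_flatten_const _ _ (l * M)) ?size_map ?size_iota//.
apply/allP => s /mapP[i _ ->].
by rewrite (size_flatten_const (grid_rows _ _ _)) size_map size_iota.
Qed.

(** If the first of [k] lines survived, then some path would have fewer than
[k] mismatches, and there would be fewer than [k] critical penalties. *)
Lemma prob_num_critical_ge m n k : (0 < n)%N ->
  (P [set t | (k <= num_critical R (fun v => omega v t) m n)%N] <=
   (death p m.+1 n ^+ k)%:E)%E.
Proof.
move=> n0; have [mF PF] := @prob_blocks 0 m.+1 n 1
  (fun bs => dead m.+1 k (head [::] bs)) n0.
apply: le_trans (_ : P [set t | dead m.+1 k (head [::] [seq bits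
    (fun v => omega v t) ((i * 0)%N, (i * n)%N) m.+1 n | i <- iota 0 1])] <= _)%E.
  have mR := measurable_num_critical m n (fun r => k <= r)%N.
  apply: le_measure; rewrite ?inE//.
  move=> t /= h; rewrite /dead; apply: contraT => alive.
  rewrite !mul0n -lt0n in alive.
  have [k0|kpos] := posnP k.
    by move: alive; rewrite k0; elim: (bits _ _ _ _).
  have /run_chain /= := alive; rewrite !add0n => ch.
  have [s [ps ds ms]] := chain_path (leqnn m) ch.
  by have := leq_trans h (num_critical_le R ps ds ms); lia.
by rewrite PF lee_fin; exact: dead_le.
Qed.

End Sampling.

(** * Mismatches in independent blocks *)

(** The least [k] for which a system of [k + 1] lines survives the block; the
cap is attained when none does, and it stays a valid number of mismatches. *)
Definition mismatches (M l : nat) (b : seq (seq bool)) : nat :=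
  find (fun k => ~~ dead M k.+1 b) (iota 0 l).

Lemma block_chain w a mu l : (l <= mu)%N ->
  chain w a ((a.1 + mu)%N, (a.2 + l)%N) (mismatches mu.+1 l (bits w a mu.+1 l)).
Proof.
move=> lmu; set b := bits _ _ _ _; rewrite /mismatches.
have [h|h] := boolP (has (fun k => ~~ dead mu.+1 k.+1 b) (iota 0 l)).
  have lt : (find (fun k => ~~ dead mu.+1 k.+1 b) (iota 0 l) < l)%N.
    by move: h; rewrite has_find size_iota.
  have := nth_find 0%N h; rewrite nth_iota// add0n /dead -lt0n.
  exact: run_chain.
rewrite hasNfind// size_iota; case: a {b h} => u r /=.
have := chain_trans (chain_diags w u r l) (chain_right w (u + l) (r + l) (mu - l)).
by rewrite addn0 -addnA subnKC.
Qed.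

Lemma blocks_chain w mu l N : (l <= mu)%N ->
  chain w (0, 0)%N ((N * mu)%N, (N * l)%N)
    (\sum_(b <- [seq bits w ((i * mu)%N, (i * l)%N) mu.+1 l | i <- iota 0 N])
      mismatches mu.+1 l b).
Proof.
move=> lmu; rewrite big_map; elim: N => [|N IH].
  by rewrite !mul0n big_nil; exact: chain_refl.
rewrite -addn1 iotaD big_cat big_seq1 /= add0n addn1.
have := chain_trans IH (block_chain w ((N * mu)%N, (N * l)%N) lmu).
by rewrite /= !mulSnr.
Qed.

Section BlockMoments.
Variables (R : realType) (p delta theta : R).
Hypotheses (p01 : 0 < p < 1) (delta0 : 0 < delta) (theta1 : 1 < theta)
  (thetadelta : theta * delta < 1).

Definition moment_bound : R := 1 + (theta - 1) * delta / (1 - theta * delta).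

Let theta0 : 0 < theta. Proof. exact: lt_trans theta1. Qed.

Let moment_bound_gt0 : 0 < moment_bound.
Proof.
rewrite ltr_pwDl// mulr_ge0 ?invr_ge0 ?subr_ge0 ?(ltW thetadelta)//.
by rewrite mulr_ge0 ?subr_ge0 ?ltW.
Qed.

(** More than [k] mismatches force [k + 1] lines to die, so the number of
mismatches has a geometric tail of ratio [delta], whatever the size of the
block. *)
Lemma mean_theta_mismatches M l : death p M l <= delta ->
  iterE (iterE (bern p) M) l (fun b => theta ^+ mismatches M l b) <= moment_bound.
Proof.
move=> dl; have [Ec Es Ea] := grid_linear p M l.
apply: (@le_trans _ _ (iterE (iterE (bern p) M) l
  (fun b => 1 + \sum_(k <- iota 0 l) (theta - 1) * theta ^+ k * (dead M k.+1 b)%:R))).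
  apply: grid_mono => // b _.
  set j := mismatches M l b.
  have jl : (j <= l)%N by rewrite /j /mismatches -[leqRHS](size_iota 0); exact: find_size.
  have deadj k : (k < j)%N -> dead M k.+1 b.
    move=> kj; have := before_find 0%N kj; rewrite nth_iota ?(leq_trans kj)// add0n.
    by move/negbFE.
  rewrite -lerBlDl subrX1 -(subnKC jl) iotaD big_cat /= ler_wpDr//.
    apply: sumr_ge0 => k _; rewrite !mulr_ge0 ?subr_ge0 ?exprn_ge0//; exact: ltW.
  rewrite mulr_sumr -(big_mkord xpredT (fun k => (theta - 1) * theta ^+ k)).
  rewrite /index_iota subn0 big_seq [leRHS]big_seq; apply: ler_sum => k.
  by rewrite mem_iota add0n => /andP[_ /deadj ->]; rewrite mulr1.
rewrite Ea Ec mean_sum; last exact: grid_linear.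
rewrite lerD2l; apply: (@le_trans _ _ (\sum_(k <- iota 0 l)
    (theta - 1) * delta * (theta * delta) ^+ k)).
  apply: ler_sum => k _; rewrite Es.
  rewrite exprMn -!mulrA ler_wpM2l ?subr_ge0 ?(ltW theta1)//.
  rewrite mulrCA ler_wpM2l ?exprn_ge0 ?(ltW theta0)// -exprS.
  apply: le_trans (dead_le p01 M l k.+1) _.
  by apply: lerXn2r => //; rewrite nnegrE ?death_ge0// ltW.
rewrite -mulr_sumr ler_wpM2l ?mulr_ge0 ?subr_ge0 ?(ltW theta1) ?(ltW delta0)//.
rewrite -[leRHS]div1r ler_pdivlMr ?subr_gt0//.
have := subrX1 (theta * delta) l.
rewrite -(big_mkord xpredT (fun k => (theta * delta) ^+ k)) /index_iota subn0.
have : 0 <= (theta * delta) ^+ l by rewrite exprn_ge0// mulr_ge0 ?ltW.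
by set S := \sum_(_ <- _) _ => h1 h2; lra.
Qed.

(** Exponential Markov inequality for the independent blocks. *)
Lemma many_mismatches_le M l N C : death p M l <= delta ->
  iterE (iterE (iterE (bern p) M) l) N
    (fun bs => (C * N < \sum_(b <- bs) mismatches M l b)%N%:R) <=
  (moment_bound / theta ^+ C) ^+ N.
Proof.
move=> dl; have lin := grid_linear p M l.
apply: (@le_trans _ _ (iterE (iterE (iterE (bern p) M) l) N
   (fun bs => (theta ^+ (C * N))^-1 * \prod_(b <- bs) theta ^+ mismatches M l b))).
  apply: (iterE_mono (grid_mono (M := M) (n := l) p01)) => bs _.
  have -> : \prod_(b <- bs) theta ^+ mismatches M l b =
      theta ^+ (\sum_(b <- bs) mismatches M l b).
    by elim: bs => [|b bs IH]; rewrite ?big_nil// !big_cons IH exprD.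
  rewrite mulrC ler_pdivlMr ?exprn_gt0//.
  case: ltnP => [lt|_]; rewrite ?mul0r ?mul1r ?exprn_ge0 ?(ltW theta0)//.
  exact: (ler_weXn2l (ltW theta1) (ltnW lt)).
rewrite iterE_scale// iterE_prod//.
rewrite expr_div_n -exprM mulrC ler_pM2r ?invr_gt0 ?exprn_gt0//.
apply: lerXn2r; rewrite ?nnegrE ?(ltW moment_bound_gt0)//; last exact: mean_theta_mismatches.
have [Ec _ _] := lin; rewrite -[leLHS]Ec; apply: grid_mono => // b _.
by rewrite exprn_ge0// ltW.
Qed.

Variables (d : measure_display) (T : measurableType d) (P : probability T R)
  (omega : nat * nat -> {RV P >-> bool}).
Hypothesis iid : iid_bernoulli p omega.

(** Outside a rare event the blocks, joined corner to corner, give a path with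
on average at most [C] mismatches per block; the rows left over, at most
one per block, are crossed at one mismatch each. *)
Lemma prob_num_critical_blocks mu l N C m n (Q : nat -> Prop) :
  (0 < l <= mu)%N -> death p mu.+1 l <= delta ->
  (N * l <= n <= N * l + N)%N -> (N * mu + N <= m)%N ->
  (forall r, (r <= C.+1 * N)%N ->
    (forall K, K * r <= K ^ 3 + 3 * (C.+1 * N))%N -> ~ Q r) ->
  (P [set t | Q (num_critical R (fun v => omega v t) m n)] <=
   ((moment_bound / theta ^+ C) ^+ N)%:E)%E.
Proof.
move=> /andP[l0 lmu] dl /andP[nlow nup] Nm nQ.
have [mF PF] := @prob_blocks _ _ _ _ _ _ p01 iid mu mu.+1 l N
  (fun bs => C * N < \sum_(b <- bs) mismatches mu.+1 l b)%N l0.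
apply: (@le_trans _ _ (P [set t | (C * N < \sum_(b <- [seq bits
   (fun v => omega v t) ((i * mu)%N, (i * l)%N) mu.+1 l | i <- iota 0 N])
     mismatches mu.+1 l b)%N])); last first.
  by rewrite PF lee_fin; exact: many_mismatches_le.
have mR := measurable_num_critical omega m n Q.
apply: le_measure; rewrite ?inE// => t /= Qt.
rewrite ltnNge; apply/negP => le.
have := chain_trans (blocks_chain (fun v => omega v t) N lmu)
  (chain_diags (fun v => omega v t) (N * mu) (N * l) (n - N * l)).
rewrite subnKC// => c1.
have bound : (\sum_(b <- [seq bits (fun v => omega v t) ((i * mu)%N, (i * l)%N)
    mu.+1 l | i <- iota 0 N]) mismatches mu.+1 l b + (n - N * l) <= C.+1 * N)%N.
  by rewrite mulSn addnC leq_add// leq_subLR.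
have um : (N * mu + (n - N * l) <= m)%N.
  by apply: leq_trans Nm; rewrite leq_add2l leq_subLR.
have [s [ps ds ms]] := chain_path um (chain_weaken bound c1).
apply: nQ Qt; first exact: num_critical_le ps ds ms.
by move=> K; exact: num_critical_cube ps ds ms K.
Qed.

End BlockMoments.

(** * The Gaussian distribution function and the heat equation *)

Lemma derive_mvt (R : realType) (f df : R -> R) (a b : R) : a <= b ->
  (forall x, a <= x <= b -> is_derive x 1 f (df x)) ->
  exists2 c, a <= c <= b & f b - f a = df c * (b - a).
Proof.
move=> ab fdf; have [||c] := @MVT_segment R f df a b ab.
- by move=> x; rewrite in_itv /= => /andP[ax xb]; apply: fdf; rewrite !ltW.
- apply: derivable_within_continuous => x; rewrite in_itv /= => /fdf h.
  exact: ex_derive.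
- by rewrite in_itv /= => acb e; exists c.
Qed.

Section Gaussian.
Variable R : realType.
Implicit Types (x y z : R).

Let peak : R := normal_peak 1.

Let peak_gt0 : 0 < peak.
Proof. exact: normal_peak_gt0. Qed.

Let density y : R := normal_pdf 0 1 y.

Let densityE y : density y = peak * expR (- (y ^+ 2 / 2)).
Proof.
rewrite /density normal_pdfE ?oner_neq0//; congr (_ * expR _).
by rewrite subr0 mulNr expr1n.
Qed.

Let density_gt0 y : 0 < density y.
Proof. by rewrite densityE mulr_gt0// expR_gt0. Qed.

Let density_le y : density y <= peak.
Proof. by apply: normal_pdf_ub; rewrite oner_neq0. Qed.

Let is_derive_density y : is_derive y 1 density (- y * density y).
Proof.
rewrite (_ : density = fun y => peak * expR (- (y ^+ 2 / 2))); last exact/funext/densityE.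
have d1 : is_derive y 1 (fun u : R => - (u ^+ 2 / 2)) (- y).
  rewrite (_ : (fun u : R => _) = (- 2^-1) *: (@id R) ^+ 2); last first.
    by apply/funext => u; rewrite mulrC -mulNr.
  by apply: is_derive_eq; rewrite /GRing.scale /= expr1; field.
have d2 : is_derive y 1 (fun u : R => expR (- (u ^+ 2 / 2))) (expR (- (y ^+ 2 / 2)) * - y).
  exact: (@is_derive1_comp R expR (fun u : R => - (u ^+ 2 / 2)) y).
have d3 := is_deriveZ peak d2.
by apply: (@is_derive_eq _ _ _ _ _ _ _ _ d3); rewrite /GRing.scale /=; ring.
Qed.

Lemma is_derive_Phi y : is_derive y 1 (@Phi R) (normal_pdf 0 1 y).
Proof.
have yy : y < y + 1 by rewrite ltrDl.
have int : lebesgue_measure.-integrable `]-oo, y + 1] (EFin \o normal_pdf 0 1).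
  by apply: integrableS (integrable_normal_pdf 0 1).
have [d1 d2] := continuous_FTC1 yy int (ltNyr _)
  (@continuous_normal_pdf R 0 1 (oner_neq0 _) y).
rewrite derive1E in d2; exact: (DeriveDef d1 d2).
Qed.

Lemma Phi_nondecreasing : {homo @Phi R : x y / x <= y}.
Proof.
move=> x y xy; rewrite /Phi fine_le ?fin_num_measure//.
by rewrite le_measure ?inE//; exact: subset_itvl.
Qed.

Lemma Phi_ge0 y : 0 <= Phi y.
Proof. by rewrite /Phi fine_ge0. Qed.

Lemma Phi_le1 y : Phi y <= 1.
Proof.
by rewrite /Phi -[leRHS]/(fine 1%:E) fine_le ?fin_num_measure// probability_le1.
Qed.

Lemma Phi_near1 (e : R) : 0 < e -> exists2 A : R, 0 <= A & 1 - e < Phi A.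
Proof.
move=> e0; have : normal_prob (0 : R) 1 `]-oo, (n%:R : R)] @[n --> \oo] --> 1%E.
  rewrite -(probability_setT (normal_prob (0 : R) 1)).
  pose F n := [set` `]-oo, (n%:R : R)]].
  have <- : \bigcup_n F n = setT.
    rewrite -subTset => t _; exists (Num.truncn t).+1 => //=.
    by rewrite /F /= in_itv/= ltW// truncnS_gt.
  apply: nondecreasing_cvg_mu => //; first exact: bigcup_measurable.
  move=> n m nm; apply/subsetPset => x/=; rewrite !in_itv/= => /le_trans.
  by apply; rewrite ler_nat.
move=> /fine_cvgP [_] /cvgrPdist_lt /(_ _ e0) [N _ /(_ N (leqnn N))] /=.
rewrite -/(Phi N%:R) ger0_norm ?subr_ge0 ?Phi_le1// => h.
by exists N%:R => //; lra.
Qed.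

Let Phi_near0 (e : R) : 0 < e -> exists2 A : R, 0 <= A & Phi (- A) < e.
Proof.
move=> e0; have : normal_prob (0 : R) 1 `]-oo, (- n%:R : R)] @[n --> \oo] --> 0%E.
  rewrite -(measure0 (normal_prob (0 : R) 1)).
  pose F n := [set` `]-oo, (- n%:R : R)]].
  have <- : \bigcap_n F n = set0.
    rewrite -subset0 => t /(_ (Num.truncn (- t)).+1 I).
    by rewrite /F /= in_itv /= => h; have := truncnS_gt (- t); lra.
  apply: nonincreasing_cvg_mu => //=.
  - by rewrite (le_lt_trans (probability_le1 _ _)) ?ltry.
  - exact: bigcap_measurable.
  - move=> n m nm; apply/subsetPset => x/=; rewrite !in_itv => /le_trans; apply.
    by rewrite lerN2 ler_nat.
move=> /fine_cvgP [_] /cvgrPdist_lt /(_ _ e0) [N _ /(_ N (leqnn N))] /=.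
rewrite -/(Phi (- N%:R)) sub0r normrN ger0_norm ?Phi_ge0// => h.
by exists N%:R.
Qed.

Lemma Phi_lipschitz x y : x <= y -> Phi y - Phi x <= peak * (y - x).
Proof.
move=> xy; have [|c _ ->] := @derive_mvt R (@Phi R) density x y xy.
- by move=> u _; exact: is_derive_Phi.
- by rewrite ler_wpM2r ?subr_ge0// density_le.
Qed.

Lemma Phi_lt1 y : Phi y < 1.
Proof.
apply: lt_le_trans (Phi_le1 (y + 1)); rewrite -subr_gt0.
have [||c _ ->] := @derive_mvt R (@Phi R) density y (y + 1).
- by rewrite lerDl.
- by move=> u _; exact: is_derive_Phi.
- by rewrite mulr_gt0// subr_gt0 ltrDl.
Qed.

(** The density is even, so [Phi y + Phi (- y)] does not depend on [y]; its
value is the limit 1. *)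
Lemma Phi0 : Phi (0 : R) = 2^-1.
Proof.
have sym y : Phi y + Phi (- y) = Phi 0 + Phi (- 0).
  apply: (@is_derive_0_is_cst _ (fun y => Phi y + Phi (- y))) => u.
  have d2 := is_derive_Phi (- u).
  have d3 : is_derive u 1 (fun y => Phi (- y)) (normal_pdf 0 1 (- u) * - 1).
    exact: (@is_derive1_comp R (@Phi R) -%R u).
  have d4 := is_deriveD (is_derive_Phi u) d3.
  apply: (@is_derive_eq _ _ _ _ _ _ _ _ d4).
  by rewrite -!/(density _) !densityE sqrrN; ring.
have comp y : Phi y + Phi (- y) = 1.
  apply/eqP/contraT; rewrite -subr_eq0 -normr_gt0 => e0.
  have [A A0 hA] := Phi_near1 (divr_gt0 e0 (@ltr0n R 2)).
  have [B B0 hB] := Phi_near0 (divr_gt0 e0 (@ltr0n R 2)).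
  pose D := Num.max A B.
  have h1 : Phi A <= Phi D by apply: Phi_nondecreasing; rewrite le_max lexx.
  have h2 : Phi (- D) <= Phi (- B).
    by apply: Phi_nondecreasing; rewrite lerN2 le_max lexx orbT.
  have h3 := Phi_le1 D; have h4 := Phi_ge0 (- D).
  have : `|Phi y + Phi (- y) - 1| < `|Phi y + Phi (- y) - 1|.
    rewrite [ltLHS](_ : _ = `|Phi D + Phi (- D) - 1|); last by rewrite !sym.
    by rewrite ltr_norml; apply/andP; split; lra.
  by rewrite ltxx.
by have := comp 0; rewrite oppr0; lra.
Qed.

(** The Gaussian density of standard deviation [k^-1], and its derivative. *)
Let kernel (k y : R) : R := k * density (k * y).
Let kernel' (k y : R) : R := - k ^+ 3 * y * density (k * y).

Let is_derive_scaled (k y : R) :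
  is_derive y 1 (fun u => density (k * u)) (- (k * y) * density (k * y) * k).
Proof.
have d1 : is_derive y 1 (fun u : R => k * u) k.
  by have := is_deriveZ k (is_derive_id y 1); rewrite /GRing.scale /= mulr1.
exact: (@is_derive1_comp R density (fun u => k * u) y).
Qed.

Let is_derive_kernel k y : is_derive y 1 (kernel k) (kernel' k y).
Proof.
have d1 := is_deriveZ k (is_derive_scaled k y).
by apply: (@is_derive_eq _ _ _ _ _ _ _ _ d1); rewrite /GRing.scale /= /kernel'; ring.
Qed.

Let is_derive_kernel' k y :
  is_derive y 1 (kernel' k) (k ^+ 3 * ((k * y) ^+ 2 - 1) * density (k * y)).
Proof.
have d0 := is_deriveZ (- k ^+ 3) (is_derive_id y 1).
have d1 := is_deriveM d0 (is_derive_scaled k y).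
apply: (@is_derive_eq _ _ _ _ _ _ _ _ d1).
rewrite (_ : (- k ^+ 3 \*: id) y = - k ^+ 3 * y)//.
by rewrite /GRing.scale /=; ring.
Qed.

Let kernel''_le (k y : R) : 0 <= k ->
  `|k ^+ 3 * ((k * y) ^+ 2 - 1) * density (k * y)| <= 2 * peak * k ^+ 3.
Proof.
move=> k0; rewrite normrM normrM (ger0_norm (exprn_ge0 3 k0)) (gtr0_norm (density_gt0 _)).
set v := k * y.
suff : `|v ^+ 2 - 1| * density v <= 2 * peak.
  by move=> h; rewrite -mulrA mulrC ler_wpM2r ?exprn_ge0.
rewrite densityE mulrCA mulrC ler_wpM2r ?(ltW peak_gt0)//.
have e1 : expR (- (v ^+ 2 / 2)) <= 1.
  by rewrite -[leRHS]expR0 ler_expR oppr_le0 divr_ge0 ?sqr_ge0.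
have e2 : v ^+ 2 * expR (- (v ^+ 2 / 2)) <= 2.
  rewrite expRN ler_pdivrMr ?expR_gt0//.
  by have := expR_ge1Dx (v ^+ 2 / 2); lra.
have e3 := expR_gt0 (- (v ^+ 2 / 2)); have v2 := sqr_ge0 v.
have [h|h] := leP 1 (v ^+ 2); first by rewrite ger0_norm ?subr_ge0//; nra.
by rewrite ltr0_norm ?subr_lt0//; nra.
Qed.

Let kernel'_lipschitz (k x y : R) : 0 <= k -> x <= y ->
  `|kernel' k y - kernel' k x| <= 2 * peak * k ^+ 3 * (y - x).
Proof.
move=> k0 xy; have [|c _ ->] := @derive_mvt R (kernel' k)
  (fun y => k ^+ 3 * ((k * y) ^+ 2 - 1) * density (k * y)) x y xy.
  by move=> u _; exact: is_derive_kernel'.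
by rewrite normrM [X in _ * X]ger0_norm ?subr_ge0// ler_wpM2r ?subr_ge0 ?kernel''_le.
Qed.

Variable p : R.
Hypothesis p01 : 0 < p < 1.

Let pq_gt0 : 0 < p * (1 - p).
Proof. by case/andP: p01 => ? ?; rewrite mulr_gt0 ?subr_gt0. Qed.

(** The inverse standard deviation at time [t] of the interpolation below. *)
Let path (s t : R) : R := (Num.sqrt (s + p * (1 - p) * (1 - t ^+ 2)))^-1.

Let is_derive_path (s t : R) : 0 < s -> 0 <= t <= 1 ->
  is_derive t 1 (path s) (p * (1 - p) * t * path s t ^+ 3).
Proof.
move=> s0 /andP[t0 t1]; have := pq_gt0; set pq := p * (1 - p) => pq0.
have pos : 0 < s + pq * (1 - t ^+ 2).
  by rewrite ltr_pwDl// mulr_ge0 ?(ltW pq0)// subr_ge0 expr_le1.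
have d1 : is_derive t 1 (fun u : R => s + pq * (1 - u ^+ 2)) (- (pq * (2 * t))).
  have d0 := is_deriveM (is_derive_id t 1) (is_derive_id t 1).
  have d := is_deriveD (is_derive_cst (s + pq) t 1) (is_deriveZ (- pq) d0).
  rewrite (_ : (fun u : R => _) = cst (s + pq) + (- pq \*: (id * id))); last first.
    apply/funext => u; rewrite [RHS](_ : _ = s + pq + (- pq) * (u * u))//.
    by ring.
  by apply: (@is_derive_eq _ _ _ _ _ _ _ _ d); rewrite /GRing.scale /=; ring.
have d2 := @is_derive1_comp R Num.sqrt _ t _ _ (is_derive1_sqrt pos) d1.
have sq0 : Num.sqrt (s + pq * (1 - t ^+ 2)) != 0 by rewrite gt_eqF// sqrtr_gt0.
have d3 := @is_deriveV R _ t _ 1 sq0 d2.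
apply: (@is_derive_eq _ _ _ _ _ _ _ _ d3).
rewrite /GRing.scale /= /path -/pq.
by field; rewrite sq0.
Qed.

Let heat (s y : R) : R := Phi (y / Num.sqrt s).

(** The Gaussian distribution functions solve the heat equation, so replacing
one centred Bernoulli step by its variance only costs a third order term.  The
interpolation shrinks the step to [t] times its size and adds the missing
variance [p * (1 - p) * (1 - t ^ 2)]; the heat equation cancels the terms of
second order in its derivative. *)
Lemma heat_bernoulli_step (s y : R) : 0 < s ->
  `|p * heat s (y - (1 - p)) + (1 - p) * heat s (y + p) -
    heat (s + p * (1 - p)) y| <= 2 * peak * (Num.sqrt s) ^- 3.
Proof.
move=> s0; have := pq_gt0; case/andP: p01 => p0 p1; set pq := p * (1 - p) => pq0.
pose line (a t : R) := (y + a * t) * path s t.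
have is_derive_line (a t : R) : 0 <= t <= 1 -> is_derive t 1 (fun u => Phi (line a u))
    (a * kernel (path s t) (y + a * t) - pq * t * kernel' (path s t) (y + a * t)).
  move=> t01; have d1 : is_derive t 1 (fun u : R => y + a * u) a.
    have := is_deriveD (is_derive_cst y t 1) (is_deriveZ a (is_derive_id t 1)).
    by rewrite /GRing.scale /= mulr1 add0r.
  have d2 := is_deriveM d1 (is_derive_path s0 t01).
  have d3 := @is_derive1_comp R (@Phi R) (line a) t _ _ (is_derive_Phi _) d2.
  apply: (@is_derive_eq _ _ _ _ _ _ _ _ d3).
  rewrite -/(density _) /line /kernel /kernel' /GRing.scale /= -/pq.
  by rewrite (mulrC (path s t) (y + a * t)); ring.
pose H t := p * Phi (line (- (1 - p)) t) + (1 - p) * Phi (line p t).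
pose H' t := pq * (kernel (path s t) (y + p * t) - kernel (path s t) (y + - (1 - p) * t)
  - t * (p * kernel' (path s t) (y + - (1 - p) * t)
         + (1 - p) * kernel' (path s t) (y + p * t))).
have is_derive_H (t : R) : 0 <= t <= 1 -> is_derive t 1 H (H' t).
  move=> t01.
  have d := is_deriveD (is_deriveZ p (is_derive_line (- (1 - p)) t t01))
    (is_deriveZ (1 - p) (is_derive_line p t t01)).
  apply: (@is_derive_eq _ _ _ _ _ _ _ _ d).
  by rewrite /GRing.scale /= /H' /pq; ring.
have path_le (t : R) : 0 <= t <= 1 -> 0 <= path s t <= (Num.sqrt s)^-1.
  move=> /andP[t0 t1]; rewrite invr_ge0 sqrtr_ge0 /= lef_pV2 ?posrE ?sqrtr_gt0//.
    by rewrite ler_wsqrtr// lerDl mulr_ge0 ?(ltW pq0)// subr_ge0 expr_le1.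
  by rewrite ltr_pwDl// mulr_ge0 ?(ltW pq0)// subr_ge0 expr_le1.
have H'_le (t : R) : 0 <= t <= 1 -> `|H' t| <= 2 * peak * (Num.sqrt s) ^- 3.
  move=> t01; have /andP[k0 kle] := path_le _ t01; rewrite /H'.
  set k := path s t in k0 kle *; case/andP: (t01) => t0 t1.
  have ab : y + - (1 - p) * t <= y + p * t by nra.
  have [|c /andP[ac cb] ->] := @derive_mvt R (kernel k) (kernel' k) _ _ ab.
    by move=> u _; exact: is_derive_kernel.
  have h1 := kernel'_lipschitz k0 ac; have h2 := kernel'_lipschitz k0 cb.
  set L := 2 * peak * k ^+ 3 in h1 h2.
  have L0 : 0 <= L by rewrite !mulr_ge0 ?exprn_ge0// ltW.
  have LL : L <= 2 * peak * (Num.sqrt s) ^- 3.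
    rewrite ler_wpM2l ?mulr_ge0 ?(ltW peak_gt0)// -exprVn.
    by apply: lerXn2r; rewrite ?nnegrE ?invr_ge0 ?sqrtr_ge0.
  apply: le_trans LL.
  have -> : y + p * t - (y + - (1 - p) * t) = t by ring.
  set A := kernel' k (y + - (1 - p) * t) in h1 *.
  set B := kernel' k (y + p * t) in h2 *.
  set Z := kernel' k c in h1 h2 *.
  have -> : pq * (Z * t - t * (p * A + (1 - p) * B)) =
     (pq * t) * (p * (Z - A) - (1 - p) * (B - Z)) by rewrite /pq; ring.
  have pqt0 : 0 <= pq * t by apply: mulr_ge0 => //; exact: ltW.
  rewrite normrM (ger0_norm pqt0).
  have pq1 : pq * t <= 1 by rewrite /pq; nra.
  have h3 : `|Z - A| <= L.
    by apply: le_trans h1 _; rewrite ler_piMr//; nra.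
  have h4 : `|B - Z| <= L.
    by apply: le_trans h2 _; rewrite ler_piMr//; nra.
  have h5 : `|p * (Z - A) - (1 - p) * (B - Z)| <= L.
    have q0 : 0 < 1 - p by rewrite subr_gt0.
    apply: le_trans (ler_normB _ _) _; rewrite !normrM (gtr0_norm p0) (gtr0_norm q0).
    rewrite [leRHS](_ : _ = p * L + (1 - p) * L); last by ring.
    by apply: lerD; apply: ler_wpM2l => //; exact: ltW.
  by apply: le_trans h5; rewrite ler_piMl.
have [c c01] := @derive_mvt R H H' 0 1 ler01 is_derive_H.
rewrite subr0 mulr1 => e; apply: le_trans (H'_le _ c01); rewrite -e.
rewrite /H /line /path /heat !mulr1 !mulr0 !addr0 expr1n subrr mulr0 addr0.
rewrite expr0n subr0 mulr1 -mulrDl addrC [p + _]addrC subrK mul1r.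
by rewrite le_eqVlt; apply/orP; left; apply/eqP; congr `|_|; rewrite addrC.
Qed.

End Gaussian.

(** * The central limit theorem for one line *)

Section DeathAsymptotics.
Variables (R : realType) (p : R).
Hypothesis p01 : 0 < p < 1.

Let p0 : 0 < p. Proof. by case/andP: p01. Qed.
Let q0 : 0 < 1 - p. Proof. by case/andP: p01 => _; rewrite subr_gt0. Qed.

Let pq : R := p * (1 - p).

Let pq0 : 0 < pq. Proof. exact: mulr_gt0. Qed.

Let C : R := 2 * normal_peak 1.

Let C0 : 0 < C. Proof. by rewrite mulr_gt0// normal_peak_gt0// oner_neq0. Qed.

(** The heat solution dominates the exact recursion of [death] up to the
initial error [eta], made small by shifting the solution by [A] standard
deviations, and the accumulated errors of the single steps.  Starting the clock
at [c0] keeps the latter bounded. *)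
Lemma death_le_Phi (A eta c0 : R) c i : 0 < c0 -> 0 <= eta -> 1 - eta <= Phi A ->
  death p c.+1 i <= Phi ((i%:R - p * c%:R + A * Num.sqrt (pq * c0)) /
    Num.sqrt (pq * (c%:R + c0))) + eta + c%:R * (C * (Num.sqrt (pq * c0)) ^- 3).
Proof.
move=> c00 eta0 hA; have s0 : 0 < pq * c0 by rewrite mulr_gt0.
have sq0 : 0 < Num.sqrt (pq * c0) by rewrite sqrtr_gt0.
have E0 : 0 <= C * (Num.sqrt (pq * c0)) ^- 3.
  by rewrite mulr_ge0 ?(ltW C0)// invr_ge0 exprn_ge0// ltW.
elim: c i => [|c IH] i.
  rewrite mulr0 subr0 add0r mul0r addr0.
  have [->|ipos] := posnP i.
    by apply: addr_ge0 => //; exact: Phi_ge0.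
  have -> : death p 1 i = 1 by case: i ipos => // i _ /=; ring.
  suff : Phi A <= Phi ((i%:R + A * Num.sqrt (pq * c0)) / Num.sqrt (pq * c0)) by lra.
  apply: Phi_nondecreasing; rewrite ler_pdivlMr// lerDr; exact: ler0n.
case: i => [|i].
  have E1 := mulr_ge0 (ler0n R c.+1) E0.
  by rewrite /= addr_ge0//; apply: addr_ge0 => //; exact: Phi_ge0.
have -> : death p c.+2 i.+1 = p * death p c.+1 i + (1 - p) * death p c.+1 i.+1 by [].
set s := pq * (c%:R + c0).
set y := (i.+1%:R - p * c.+1%:R + A * Num.sqrt (pq * c0)).
have spos : 0 < s by rewrite mulr_gt0// ltr_wpDl.
have := heat_bernoulli_step p01 y spos.
have -> : s + p * (1 - p) = pq * (c.+1%:R + c0) by rewrite /s -natr1 /pq; ring.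
have := IH i; have := IH i.+1; rewrite -/s.
have -> : i%:R - p * c%:R + A * Num.sqrt (pq * c0) = y - (1 - p).
  by rewrite /y -!natr1; ring.
have -> : i.+1%:R - p * c%:R + A * Num.sqrt (pq * c0) = y + p.
  by rewrite /y -!natr1; ring.
have E : C * (Num.sqrt s) ^- 3 <= C * (Num.sqrt (pq * c0)) ^- 3.
  rewrite ler_pM2l// lef_pV2 ?posrE ?exprn_gt0 ?sqrtr_gt0//.
  apply: lerXn2r; rewrite ?nnegrE ?sqrtr_ge0// ler_wsqrtr//.
  by rewrite ler_pM2l// lerDr.
rewrite -/C in E *; move: E.
set e := C * _; set e' := C * _ ; set f1 := Phi _; set f2 := Phi _; set f3 := Phi _.
move=> ee' h1 h2; rewrite ler_norml => /andP[_ h3].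
rewrite -natr1 [in leRHS]mulrDl mul1r.
have := ltW p0; have := ltW q0.
set d1 := death _ _ _ in h2 *; set d2 := death _ _ _ in h1 *.
set g := c%:R * e' in h1 h2 *.
move=> q0' p0'.
have k1 : p * d1 <= p * (f2 + eta + g) by apply: ler_wpM2l.
have k2 : (1 - p) * d2 <= (1 - p) * (f1 + eta + g) by apply: ler_wpM2l.
have k3 : p * (f2 + eta + g) + (1 - p) * (f1 + eta + g) = p * f2 + (1 - p) * f1 + eta + g by ring.
by lra.
Qed.

(** The upper half of the central limit theorem.  With the clock started at
[e ^ 2 * m] the shift is [A * e] standard deviations, which is small with [e],
while the [m] step errors of order [(e ^ 2 * m) ^ (- 3 / 2)] sum up to a term
that vanishes as [m] grows. *)
Lemma death_clt (z gamma : R) : 0 < gamma ->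
  exists2 kappa, 0 < kappa & exists M0 : nat, forall m n : nat, (M0 <= m)%N ->
    n%:R - p * m%:R <= (z + kappa) * Num.sqrt (pq * m%:R) ->
    death p m.+1 n <= Phi z + gamma.
Proof.
move=> gamma0; have g4 : 0 < gamma / 4 by rewrite divr_gt0.
have [A A0 hA] := Phi_near1 g4.
pose rho := gamma / (2 * C).
have rho0 : 0 < rho by rewrite divr_gt0// mulr_gt0.
pose e := Num.min 1 (rho / (3 * (A + `|z| + 1))).
have D0 : 0 < A + `|z| + 1 by rewrite ltr_wpDl// addr_ge0.
have e0 : 0 < e by rewrite lt_min ltr01 divr_gt0// mulr_gt0.
have e1 : e <= 1 by rewrite ge_min lexx.
have eD : e * (A + `|z| + 1) <= rho / 3.
  rewrite -ler_pdivlMr// -mulrA -invfM ge_min; apply/orP; right.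
  by rewrite (mulrC 3).
exists (rho / 3); first by rewrite divr_gt0.
pose S0 := 4 * C / (e ^+ 3 * pq * gamma).
have e3 : 0 < e ^+ 3 by exact: exprn_gt0.
have S00 : 0 < S0.
  by apply: divr_gt0; apply: mulr_gt0 => //; exact: mulr_gt0.
exists (Num.truncn (S0 ^+ 2 / pq)).+1 => m n Mm hn.
have mpos : (0 < m)%N by apply: leq_trans Mm.
have m0 : (0 : R) < m%:R by rewrite ltr0n.
pose S := Num.sqrt (pq * m%:R).
have Spos : 0 < S by rewrite sqrtr_gt0 mulr_gt0.
have S2 : S ^+ 2 = pq * m%:R by rewrite sqr_sqrtr// ltW// mulr_gt0.
have SS0 : S0 <= S.
  rewrite -(@ler_pXn2r _ 2)// ?nnegrE ?(ltW S00) ?(ltW Spos)// S2 mulrC.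
  rewrite -ler_pdivrMr//; apply: le_trans (ltW (truncnS_gt _)) _.
  by rewrite ler_nat.
have c00 : 0 < e ^+ 2 * m%:R by rewrite mulr_gt0// exprn_gt0.
have := death_le_Phi m n c00 (ltW g4) (ltW hA).
have -> : Num.sqrt (pq * (e ^+ 2 * m%:R)) = e * S.
  rewrite mulrCA sqrtrM ?exprn_ge0 ?(ltW e0)// sqrtr_sqr gtr0_norm//.
pose r := Num.sqrt (1 + e ^+ 2).
have r1 : 1 <= r.
  by rewrite -[leLHS]sqrtr1 ler_wsqrtr// lerDl exprn_ge0// ltW.
have r2 : r ^+ 2 = 1 + e ^+ 2 by rewrite sqr_sqrtr// addr_ge0// exprn_ge0// ltW.
have -> : Num.sqrt (pq * (m%:R + e ^+ 2 * m%:R)) = r * S.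
  rewrite -[X in _ * (X + _)]mul1r -mulrDl mulrCA sqrtrM// addr_ge0// exprn_ge0//.
  exact: ltW.
move=> h; apply: le_trans h _.
have T3 : m%:R * (C * (e * S) ^- 3) <= gamma / 4.
  have -> : m%:R * (C * (e * S) ^- 3) = (C / (e ^+ 3 * pq)) / S.
    rewrite (_ : m%:R = S ^+ 2 / pq); last by rewrite S2 mulrC mulKf// gt_eqF.
    by field; rewrite !gt_eqF.
  rewrite ler_pdivrMr// -ler_pdivrMl//; apply: le_trans SS0.
  by rewrite le_eqVlt; apply/orP; left; apply/eqP; rewrite /S0; field; rewrite !gt_eqF.
have T1 : Phi ((n%:R - p * m%:R + A * (e * S)) / (r * S)) <= Phi (z + rho).
  apply: Phi_nondecreasing; rewrite ler_pdivrMr ?mulr_gt0// ?(lt_le_trans _ r1)//.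
  rewrite mulrA; apply: (@le_trans _ _ ((z + rho / 3 + A * e) * S)).
    by rewrite [leRHS]mulrDl lerD2r.
  rewrite mulrA ler_pM2r//.
  have z1 : z <= `|z| := ler_norm z.
  have z2 : - `|z| <= z by rewrite lerNl; have := ler_norm (- z); rewrite normrN.
  have z0 : 0 <= `|z| := normr_ge0 z.
  have re : r - 1 <= e ^+ 2 by rewrite -(lerD2l 1) addrC subrK -r2; nra.
  have ee : e ^+ 2 <= e by nra.
  have h1 : `|z| * (r - 1) <= `|z| * e by apply: ler_wpM2l => //; lra.
  have h2 : - `|z| * (r - 1) <= z * (r - 1) by apply: ler_wpM2r => //; lra.
  have h3 : 0 <= rho * (r - 1) by rewrite mulr_ge0 ?subr_ge0// ltW.
  have h4 : 0 <= e by exact: ltW.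
  have : (z + rho) * r = z + rho + z * (r - 1) + rho * (r - 1) by ring.
  have : e * (A + `|z| + 1) = A * e + `|z| * e + e by ring.
  by move: eD h1 h2 h3 h4; lra.
have T2 : Phi (z + rho) <= Phi z + gamma / 4.
  have := @Phi_lipschitz R z (z + rho); rewrite lerDl (ltW rho0) => /(_ isT).
  have -> : normal_peak 1 * (z + rho - z) = gamma / 4.
    rewrite /rho /C; field.
    by rewrite gt_eqF// normal_peak_gt0// oner_neq0.
  by lra.
by lra.
Qed.

End DeathAsymptotics.

(** * Asymptotics of the number of columns *)

Section PowersOfIndices.
Variable R : realType.

Lemma cvg_powRN_nat (b : R) : 0 < b -> (n%:R : R) `^ (- b) @[n --> \oo] --> 0.
Proof.
move=> b0; apply/cvgrPdist_le => e e0.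
have eb : 0 < e^-1 `^ b^-1 by rewrite powR_gt0// invr_gt0.
near=> n; rewrite sub0r normrN ger0_norm ?powR_ge0// powRN.
have nb : e^-1 `^ b^-1 <= n%:R by near: n; exact: nbhs_infty_ger.
have n0 : (0 : R) < n%:R by exact: lt_le_trans nb.
rewrite -[leRHS]invrK lef_pV2 ?posrE ?invr_gt0 ?powR_gt0//.
rewrite -[leLHS](_ : (e^-1 `^ b^-1) `^ b = _).
  by apply: ge0_ler_powR; rewrite ?nnegrE ?(ltW b0) ?(ltW eb) ?(ltW n0).
by rewrite -powRrM mulVf ?gt_eqF// powRr1// ltW// invr_gt0.
Unshelve. all: by end_near. Qed.

Lemma cvg_scaled_powRN_nat (c b : R) : 0 < b ->
  c * n%:R `^ (- b) @[n --> \oo] --> 0.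
Proof.
by move=> b0; rewrite -(mulr0 c); apply: cvgM; [exact: cvg_cst|exact: cvg_powRN_nat].
Qed.

Lemma limn_esup_le_near (u : (\bar R)^nat) (c : \bar R) :
  (\forall n \near \oo, u n <= c)%E -> (limn_esup u <= c)%E.
Proof.
move=> uc; rewrite /limn_esup /limf_esup.
apply: le_trans (_ : ereal_sup [set u n | n in [set n | (u n <= c)%E]] <= _)%E.
  by apply: ereal_inf_lbound; exists [set n | (u n <= c)%E].
by apply: ge_ereal_sup => _ [n /= nc <-].
Qed.

Lemma exprD_le (b g : R) k : 0 <= b <= 1 -> 0 <= g <= 1 ->
  (b + g) ^+ k <= b ^+ k + 3 ^+ k * g.
Proof.
move=> /andP[b0 b1] /andP[g0 g1]; elim: k => [|k IH]; first by rewrite !expr0; lra.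
have bk0 := exprn_ge0 k b0; have bk1 : b ^+ k <= 1 by rewrite exprn_ile1.
have t1 : (1 : R) <= 3 ^+ k by rewrite exprn_ege1// ler1n.
have h1 : (b + g) * (b + g) ^+ k <= (b + g) * (b ^+ k + 3 ^+ k * g).
  by rewrite ler_wpM2l// addr_ge0.
rewrite !exprS; apply: le_trans h1 _.
have h2 : g * b ^+ k <= g * 3 ^+ k by rewrite ler_wpM2l//; lra.
have h3 : (b + g) * (3 ^+ k * g) <= 2 * (3 ^+ k * g).
  by rewrite ler_wpM2r ?mulr_ge0//; lra.
by lra.
Qed.

End PowersOfIndices.

Section Columns.
Variables (R : realType) (p x a : R).
Hypotheses (p01 : 0 < p < 1) (a1 : a < 1).

Let p0 : 0 < p. Proof. by case/andP: p01. Qed.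
Let q0 : 0 < 1 - p. Proof. by case/andP: p01 => _; rewrite subr_gt0. Qed.

Lemma m_lower n : n%:R / p - x * n%:R `^ a - 1 <= (m_ p x a n)%:R.
Proof. by have := truncnS_gt (n%:R / p - x * n%:R `^ a); rewrite -natr1 /m_; lra. Qed.

Lemma m_upper n : 0 <= n%:R / p - x * n%:R `^ a ->
  (m_ p x a n)%:R <= n%:R / p - x * n%:R `^ a.
Proof. by rewrite -truncn_le. Qed.

Lemma cvg_m_ratio : p * (m_ p x a n)%:R / n%:R @[n --> \oo] --> (1 : R).
Proof.
apply/cvgrPdist_le => e e0.
have err : p * `|x| * n%:R `^ (- (1 - a)) + p * n%:R `^ (- 1) @[n --> \oo] --> (0 : R).
  rewrite -[X in _ --> X](addr0 0).
  by apply: cvgD; apply: cvg_scaled_powRN_nat; rewrite ?subr_gt0.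
near=> n.
have n1 : (1 <= n)%N by near: n; exact: nbhs_infty_ge.
have n0 : (0 : R) < n%:R by rewrite ltr0n.
have : `|p * `|x| * n%:R `^ (- (1 - a)) + p * n%:R `^ (- 1)| < e.
  by near: n; apply: cvgr0_norm_lt e0; exact: err.
move=> /ltW; apply: le_trans; rewrite [leRHS]ger0_norm; last first.
  by rewrite addr_ge0// !mulr_ge0 ?powR_ge0 ?(ltW p0).
have eqa : n%:R `^ (- (1 - a)) = n%:R `^ a / n%:R :> R.
  by rewrite opprB powRB ?(powRr1 (ltW n0))// (gt_eqF n0) implybT.
rewrite eqa (powR_inv1 (ltW n0)) -(ler_pM2r n0).
rewrite -[X in _ * X <= _](gtr0_norm n0) -normrM mulrBl mul1r divfK ?gt_eqF//.
rewrite mulrDl -!mulrA mulVf ?gt_eqF// !mulr1.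
have na := powR_ge0 (n%:R : R) a.
have low : n%:R - p * (x * n%:R `^ a) - p <= p * (m_ p x a n)%:R.
  rewrite (_ : _ - p = p * (n%:R / p - x * n%:R `^ a - 1)); last first.
    by field; rewrite gt_eqF.
  by rewrite ler_pM2l// m_lower.
have xx1 : x * n%:R `^ a <= `|x| * n%:R `^ a by rewrite ler_wpM2r// ler_norm.
have xx2 : - (x * n%:R `^ a) <= `|x| * n%:R `^ a.
  by rewrite -mulNr ler_wpM2r// -normrN ler_norm.
have pxx1 := ler_wpM2l (ltW p0) xx1; have pxx2 := ler_wpM2l (ltW p0) xx2.
have m0 : (0 : R) <= (m_ p x a n)%:R := ler0n _ _.
rewrite ler_norml; apply/andP; split; last by lra.
have [y0|y0] := leP 0 (n%:R / p - x * n%:R `^ a).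
  have := ler_wpM2l (ltW p0) (m_upper y0).
  rewrite (_ : p * (_ - _) = n%:R - p * (x * n%:R `^ a)); last first.
    by field; rewrite gt_eqF.
  by lra.
have m1 : p * (m_ p x a n)%:R = 0.
  rewrite /m_ (_ : Num.truncn _ = 0%N) ?mulr0//.
  by apply/truncn0Pn; rewrite -ltNge; lra.
have := ltr_pM2l p0 (n%:R / p) (x * n%:R `^ a).
rewrite (_ : p * (n%:R / p) = n%:R); last by field; rewrite gt_eqF.
have -> : n%:R / p < x * n%:R `^ a by lra.
by rewrite m1; lra.
Unshelve. all: by end_near. Qed.

(** The expected number of successes in [m] trials falls short of [n] by about
[p * x * n ^ a], and its standard deviation is about [sqrt ((1 - p) * n)]; both
are compared after division by [sqrt n]. *)
Lemma m_deficit (L kappa : R) : 0 < kappa ->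
  (p * x * n%:R `^ (a - 2^-1) @[n --> \oo] --> L) ->
  \forall n \near \oo, n%:R - p * (m_ p x a n)%:R <=
    (L / Num.sqrt (1 - p) + kappa) * Num.sqrt (p * (1 - p) * (m_ p x a n)%:R).
Proof.
move=> k0 cvgL; have sq0 : 0 < Num.sqrt (1 - p) by rewrite sqrtr_gt0.
pose f n := (L / Num.sqrt (1 - p) + kappa) * Num.sqrt (1 - p) *
    Num.sqrt (p * (m_ p x a n)%:R / n%:R) -
  (p * x * n%:R `^ (a - 2^-1) + p * n%:R `^ (- 2^-1)).
have cf : f n @[n --> \oo] --> kappa * Num.sqrt (1 - p).
  rewrite (_ : kappa * _ = (L / Num.sqrt (1 - p) + kappa) * Num.sqrt (1 - p) *
    Num.sqrt 1 - (L + 0)); last by rewrite sqrtr1; field; rewrite gt_eqF.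
  apply: cvgB; last first.
    by apply: cvgD => //; apply: cvg_scaled_powRN_nat; rewrite invr_gt0.
  apply: cvgM; first exact: cvg_cst.
  apply: continuous_cvg; first exact: sqrt_continuous.
  exact: cvg_m_ratio.
near=> n.
have n1 : (1 <= n)%N by near: n; exact: nbhs_infty_ge.
have n0 : (0 : R) < n%:R by rewrite ltr0n.
have f0 : 0 < f n by near: n; apply: (cvgr_gt _ cf); rewrite mulr_gt0.
have s0 : 0 < Num.sqrt (n%:R : R) by rewrite sqrtr_gt0.
have e1 : Num.sqrt (p * (1 - p) * (m_ p x a n)%:R) =
    Num.sqrt n%:R * (Num.sqrt (1 - p) * Num.sqrt (p * (m_ p x a n)%:R / n%:R)).
  rewrite -!sqrtrM ?(ltW q0) ?(ltW n0)//; congr Num.sqrt.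
  by field; rewrite gt_eqF.
have e2 : Num.sqrt n%:R * n%:R `^ (a - 2^-1) = n%:R `^ a :> R.
  rewrite -powR12_sqrt ?ltW// -powRD ?(gt_eqF n0) ?implybT//.
  by congr (_ `^ _); rewrite addrC subrK.
have e3 : Num.sqrt n%:R * n%:R `^ (- 2^-1) = 1 :> R.
  by rewrite -powR12_sqrt ?ltW// powRN divff// gt_eqF// powR_gt0.
have : 0 <= Num.sqrt n%:R * f n by rewrite mulr_ge0// ltW.
rewrite /f e1 mulrBr mulrDr.
rewrite (mulrCA _ (p * x)) e2 (mulrCA _ p) e3.
have low : n%:R - p * x * n%:R `^ a - p <= p * (m_ p x a n)%:R.
  rewrite (_ : _ - p = p * (n%:R / p - x * n%:R `^ a - 1)); last first.
    by field; rewrite gt_eqF.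
  by rewrite ler_pM2l// m_lower.
set u := Num.sqrt n%:R; set v := Num.sqrt (1 - p); set w := Num.sqrt _.
have -> : (L / v + kappa) * (u * (v * w)) = u * ((L / v + kappa) * v * w) by ring.
by lra.
Unshelve. all: by end_near. Qed.

Lemma m_infty (M0 : nat) : \forall n \near \oo, (M0 <= m_ p x a n)%N.
Proof.
have half : 2^-1 < 1 :> R by lra.
near=> n.
have n1 : (1 <= n)%N by near: n; exact: nbhs_infty_ge.
have n0 : (0 : R) < n%:R by rewrite ltr0n.
have nM : 2 * M0%:R <= n%:R :> R by near: n; exact: nbhs_infty_ger.
have : 2^-1 < p * (m_ p x a n)%:R / n%:R by near: n; exact: (cvgr_gt 1 cvg_m_ratio).
rewrite ltr_pdivlMr// => h1; rewrite -(ler_nat R).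
have : p * (m_ p x a n)%:R <= (m_ p x a n)%:R.
  by rewrite ler_piMl// ltW//; case/andP: p01.
by lra.
Unshelve. all: by end_near. Qed.

End Columns.

(** * Cutting the box into blocks *)

Section BlockSizes.
Variables (R : realType) (p : R).
Hypothesis p01 : 0 < p < 1.

Let p0 : 0 < p. Proof. by case/andP: p01. Qed.

(** In a block of [l] rows whose width falls short of [l / p] by [sqrt l], which
is of the order of the fluctuations, a single line still survives with
probability bounded below; this is the central limit theorem with [x = 1] and
[a = 1 / 2]. *)
Lemma death_block_lt1 : exists2 delta : R, 0 < delta < 1 &
  \forall l \near \oo,
    (l <= m_ p 1 2^-1 l)%N /\ death p (m_ p 1 2^-1 l).+1 l <= delta.
Proof.
pose z := p / Num.sqrt (1 - p).
pose delta := (1 + Phi z) / 2.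
have z1 := Phi_lt1 z; have z0 := Phi_ge0 z.
exists delta; first by rewrite /delta; apply/andP; split; lra.
have half1 : 2^-1 < 1 :> R by lra.
have gamma0 : 0 < (1 - Phi z) / 2 by rewrite divr_gt0// subr_gt0.
have [kappa k0 [M0 clt]] := death_clt p01 z gamma0.
have deficit := @m_deficit R p 1 2^-1 p01 half1 p kappa k0.
have cp : p * 1 * n%:R `^ (2^-1 - 2^-1) @[n --> \oo] --> p.
  under eq_fun do rewrite subrr powRr0 !mulr1.
  exact: cvg_cst.
have {}deficit := deficit cp.
have ratio := cvg_m_ratio 1 p01 half1.
have p1 : p < 1 by case/andP: p01.
near=> l; split.
  have l1 : (1 <= l)%N by near: l; exact: nbhs_infty_ge.
  have l0 : (0 : R) < l%:R by rewrite ltr0n.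
  have : p < p * (m_ p 1 2^-1 l)%:R / l%:R by near: l; exact: (cvgr_gt 1 ratio).
  by rewrite ltr_pdivlMr// ltr_pM2l// ltr_nat => /ltnW.
have -> : delta = Phi z + (1 - Phi z) / 2 by rewrite /delta; lra.
apply: clt; last by near: l.
by near: l; exact: m_infty.
Unshelve. all: by end_near. Qed.

Lemma m_block_le l : (2 <= l)%N -> (l <= m_ p 1 2^-1 l)%N ->
  (m_ p 1 2^-1 l)%:R <= l%:R / p - Num.sqrt l%:R :> R.
Proof.
move=> l2 lm; have l0 : (0 : R) <= l%:R := ler0n _ _.
have := @m_upper R p 1 2^-1 l; rewrite mul1r powR12_sqrt//; apply.
have : (0 < m_ p 1 2^-1 l)%N by apply: leq_trans lm; lia.
by rewrite /m_ mul1r powR12_sqrt// truncn_gt0; lra.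
Qed.

End BlockSizes.

(** The rate is so large that giving up the square root of its height in the
width of each block pays for the total deficit [x * n ^ a] of columns. *)
Definition block_rate (R : realType) (x : R) : R := 2 * (`|x| + 1) ^+ 2.

Definition block_count (R : realType) (x a : R) (n : nat) : nat :=
  (Num.truncn (block_rate x * n%:R `^ (2 * a - 1))).+1.

Section BlockCounts.
Variables (R : realType) (x : R).

Lemma block_rate_gt0 : 0 < block_rate x.
Proof. by rewrite mulr_gt0// exprn_gt0// ltr_wpDl. Qed.

Lemma block_count_le (a : R) n :
  (block_count x a n)%:R <= block_rate x * n%:R `^ (2 * a - 1) + 1.
Proof.
rewrite /block_count -natr1 lerD2r truncn_le.
by apply: mulr_ge0; [exact/ltW/block_rate_gt0|exact: powR_ge0].
Qed.

Lemma block_count_ge (a : R) n :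
  block_rate x * n%:R `^ (2 * a - 1) <= (block_count x a n)%:R.
Proof. exact/ltW/truncnS_gt. Qed.

End BlockCounts.

Lemma block_division n N L : (0 < N)%N -> (N * L.+2 <= n)%N ->
  exists2 l, (L <= l)%N & (N * l <= n <= N * l + N)%N /\ (n <= 2 * (N * l))%N.
Proof.
move=> N0 NL; exists (n %/ N)%N; first by rewrite leq_divRL//; nia.
have := divn_eq n N; have := ltn_pmod n N0.
have : (L.+2 <= n %/ N)%N by rewrite leq_divRL// mulnC.
by move: (n %/ N)%N (n %% N)%N => l r ? ? ?; split; nia.
Qed.

(** With [N] blocks of [l] rows, about [n / N], the width given up is
[N * sqrt l >= sqrt (N * n / 2) >= (`|x| + 1) * n ^ a], because [N * n] is at
least [block_rate x * n ^ (2 a)].  The surplus [n ^ a] absorbs the [N] columns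
reserved for the rows left over, since [N] is of smaller order. *)
Lemma blocks_fit (R : realType) (p x a : R) (L0 : nat) : 0 < p < 1 ->
  2^-1 < a < 1 ->
  \forall n \near \oo, exists2 l, (L0 <= l)%N &
    [/\ (block_count x a n * l <= n <= block_count x a n * l + block_count x a n)%N &
     (forall mu, mu%:R <= l%:R / p - Num.sqrt l%:R ->
       (block_count x a n * mu + block_count x a n <= m_ p x a n)%N)].
Proof.
move=> p01 /andP[a12 a1]; pose c := block_rate x; have c0 : 0 < c := block_rate_gt0 x.
have p0 : 0 < p by case/andP: p01.
have cv1 : c * n%:R `^ (- (2 - 2 * a)) + 1 * n%:R `^ (- 1) @[n --> \oo] --> (0 : R).
  rewrite -[X in _ --> X](addr0 0).
  by apply: cvgD; apply: cvg_scaled_powRN_nat; lra.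
have cv2 : c * n%:R `^ (- (1 - a)) + 2 * n%:R `^ (- a) @[n --> \oo] --> (0 : R).
  rewrite -[X in _ --> X](addr0 0).
  by apply: cvgD; apply: cvg_scaled_powRN_nat; lra.
have L1 : 0 < (L0.+2%:R : R)^-1 by rewrite invr_gt0 ltr0n.
near=> n.
have n1 : (1 <= n)%N by near: n; exact: nbhs_infty_ge.
have n0 : (0 : R) < n%:R by rewrite ltr0n.
have pw b d : n%:R `^ (b - d) = n%:R `^ b / n%:R `^ d :> R.
  by rewrite powRB// (gt_eqF n0) implybT.
have n12a : n%:R `^ (2 * a) = n%:R `^ a * n%:R `^ a :> R.
  by rewrite mulr2n mulrDl mul1r powRD// (gt_eqF n0) implybT.
have na0 : 0 < n%:R `^ a :> R by rewrite powR_gt0.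
have npow : n%:R `^ (2 * a - 1) = n%:R `^ a * n%:R `^ a / n%:R :> R.
  by rewrite pw (powRr1 (ltW n0)) n12a.
have few : (block_count x a n)%:R * L0.+2%:R <= n%:R :> R.
  have : `|c * n%:R `^ (- (2 - 2 * a)) + 1 * n%:R `^ (- 1)| < (L0.+2%:R : R)^-1.
    by near: n; apply: cvgr0_norm_lt L1; exact: cv1.
  move=> /ltr_normlW; rewrite -ler_pdivlMr ?ltr0n// => h.
  apply: le_trans (block_count_le _ _ _) _; move: h.
  rewrite opprB (_ : 2 * a - 2 = 2 * a - 1 - 1); last by ring.
  rewrite (pw (2 * a - 1)) (powRr1 (ltW n0)) (powR_inv1 (ltW n0)) mul1r => /ltW h.
  have h2 := ler_wpM2r (ltW n0) h.
  rewrite -/c [leRHS]mulrC; apply: le_trans h2; rewrite le_eqVlt; apply/orP; left.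
  by apply/eqP; field; rewrite gt_eqF.
have small : (block_count x a n)%:R + 1 <= n%:R `^ a :> R.
  have : `|c * n%:R `^ (- (1 - a)) + 2 * n%:R `^ (- a)| < 1 :> R.
    by near: n; apply: cvgr0_norm_lt; [exact: cv2|].
  move=> /ltr_normlW/ltW; rewrite opprB pw (powRr1 (ltW n0)) powRN => h.
  have := ler_wpM2r (ltW na0) h; rewrite mul1r => {}h.
  have := block_count_le x a n; rewrite npow -/c => h1.
  have h2 : (c * (n%:R `^ a / n%:R) + 2 / n%:R `^ a) * n%:R `^ a =
      c * (n%:R `^ a * n%:R `^ a / n%:R) + 2 :> R.
    by field; rewrite !gt_eqF.
  by lra.
have N0 : (0 < block_count x a n)%N by [].
have N0' : (0 : R) < (block_count x a n)%:R by rewrite ltr0n.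
have Nge := block_count_ge x a n.
set N := block_count x a n in few small N0 N0' Nge *.
have NL : (N * L0.+2 <= n)%N by rewrite -(ler_nat R) natrM.
have [l lL [Nl l2']] := block_division N0 NL.
exists l => //; split=> // mu hmu.
have l2 : n%:R <= 2 * (N%:R * l%:R) :> R by rewrite -natrM -(natrM _ 2) ler_nat.
have s0 : 0 <= Num.sqrt (l%:R : R) by exact: sqrtr_ge0.
have gain : (`|x| + 1) * n%:R `^ a <= N%:R * Num.sqrt l%:R.
  rewrite -(@ler_pXn2r _ 2)// ?nnegrE ?mulr_ge0 ?addr_ge0 ?(ltW na0)//.
  rewrite !exprMn sqr_sqrtr ?ler0n//.
  have h1 : N%:R * n%:R <= 2 * (N%:R ^+ 2 * l%:R) :> R.
    by have := ler_wpM2l (ltW N0') l2; lra.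
  have h2 : c * (n%:R `^ a * n%:R `^ a) <= N%:R * n%:R.
    by rewrite -ler_pdivrMr// -mulrA -npow.
  have h3 : c * (n%:R `^ a * n%:R `^ a) = 2 * ((`|x| + 1) ^+ 2 * n%:R `^ a ^+ 2).
    by rewrite /c /block_rate; ring.
  by rewrite -(@ler_pM2l _ 2)// -h3; apply: le_trans h2 h1.
rewrite -(ler_nat R) natrD natrM.
apply: le_trans (m_lower p x a n).
have h1 := ler_wpM2l (ltW N0') hmu.
have h2 : N%:R * l%:R <= n%:R :> R by rewrite -natrM ler_nat; case/andP: Nl.
have pV0 : 0 < p^-1 by rewrite invr_gt0.
have h3 := ler_wpM2r (ltW pV0) h2.
have h4 : x * n%:R `^ a <= `|x| * n%:R `^ a by rewrite ler_wpM2r ?ler_norm// ltW.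
rewrite mulrBr mulrA in h1.
by move: gain small; rewrite mulrDl mul1r; lra.
Unshelve. all: by end_near. Qed.

(** There are about [n ^ (2 a - 1)] blocks, each with a bounded exponential
moment of mismatches, so a path with [j] mismatches of that order exists with
high probability.  [Q] stands for any property of the number of critical
penalties that the two bounds in terms of [j] exclude. *)
Lemma few_mismatches (R : realType) (p x : R) : 0 < p < 1 ->
  exists2 B : R, 0 < B &
  forall (d : measure_display) (T : measurableType d) (P : probability T R)
      (omega : nat * nat -> {RV P >-> bool}),
    iid_bernoulli p omega ->
    forall a : R, 2^-1 < a < 1 -> forall Q : nat -> nat -> Prop,
    (forall n j r, (0 < n)%N -> j%:R <= B * n%:R `^ (2 * a - 1) ->
      (r <= j)%N -> (forall K, K * r <= K ^ 3 + 3 * j)%N -> ~ Q n r) ->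
    P [set t | Q n (num_critical R (fun v => omega v t) (m_ p x a n) n)]
      @[n --> \oo] --> 0%E.
Proof.
move=> p01; have [delta /andP[delta0 delta1] [L0 _ block]] := death_block_lt1 p01.
pose theta := (1 + delta^-1) / 2.
have dV : 1 < delta^-1 by rewrite invf_gt1.
have theta1 : 1 < theta by rewrite /theta; lra.
have td : theta * delta < 1.
  by rewrite /theta mulrAC mulrDl mulVf ?gt_eqF// mul1r; lra.
pose K := moment_bound delta theta.
have [C hC] : exists C, 2 * K <= theta ^+ C.
  have bern_ineq k : 1 + k%:R * (theta - 1) <= theta ^+ k.
    elim: k => [|k IH]; first by rewrite mul0r addr0.
    have t1 : 1 <= theta ^+ k by rewrite exprn_ege1// ltW.
    have : 0 <= (theta ^+ k - 1) * (theta - 1) by rewrite mulr_ge0 ?subr_ge0// ltW.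
    by rewrite exprSr -natr1; move: IH; lra.
  exists (Num.truncn (2 * K / (theta - 1))).+1; apply: le_trans (bern_ineq _).
  have := truncnS_gt (2 * K / (theta - 1)); rewrite ltr_pdivrMr ?subr_gt0//.
  by lra.
pose c := block_rate x; have c0 : 0 < c := block_rate_gt0 x.
exists (C.+1%:R * (c + 1)).
  by rewrite mulr_gt0// ?ltr0n// addr_gt0.
move=> d T P omega iid a a01 Q nQ.
have [a12 a1] := andP a01.
have [N1 _ fit] := blocks_fit x (maxn L0 2) p01 a01.
apply: (@squeeze_cvge _ _ _ _ (fun=> 0%E) _
  (fun n => (c^-1 * n%:R `^ (- (2 * a - 1)))%:E)).
- near=> n.
  have n1 : (1 <= n)%N by near: n; exact: nbhs_infty_ge.
  have n0 : (0 : R) < n%:R by rewrite ltr0n.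
  apply/andP; split=> //.
  have N1n : (N1 <= n)%N by near: n; exact: nbhs_infty_ge.
  have [l lL [nl mmu]] := fit n N1n.
  have [lm dl] : (l <= m_ p 1 2^-1 l)%N /\ death p (m_ p 1 2^-1 l).+1 l <= delta.
    by apply: block => /=; apply: leq_trans lL; rewrite leq_maxl.
  have l2 : (2 <= l)%N by apply: leq_trans lL; rewrite leq_maxr.
  have mu_le := m_block_le p01 l2 lm.
  have lpos : (0 < l <= m_ p 1 2^-1 l)%N by rewrite lm andbT (leq_trans _ l2).
  have pa0 : (0 : R) < n%:R `^ (2 * a - 1) by rewrite powR_gt0.
  have Nle := block_count_le x a n; have Nge := block_count_ge x a n.
  rewrite -/c in Nle Nge; set N := block_count x a n in nl mmu Nle Nge.
  have pa1 : 1 <= n%:R `^ (2 * a - 1) :> R.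
    rewrite -[leLHS](powRr0 (n%:R : R)); apply: ler_powR; first by rewrite ler1n.
    by lra.
  have := prob_num_critical_blocks p01 delta0 theta1 td iid (C := C) lpos dl nl
    (mmu _ mu_le) (Q := Q n).
  move=> /(_ _)/le_trans; apply.
    move=> r rC rK; apply: (nQ n (C.+1 * N)%N) => //.
    rewrite natrM -mulrA ler_wpM2l// mulrDl mul1r; lra.
  rewrite lee_fin -/K.
  have K0 : 0 <= K.
    rewrite /K /moment_bound addr_ge0// mulr_ge0 ?invr_ge0 ?subr_ge0 ?(ltW td)//.
    by rewrite mulr_ge0 ?subr_ge0 ?(ltW theta1) ?(ltW delta0).
  have tC : 0 < theta ^+ C by rewrite exprn_gt0//; lra.
  have N0 : (0 : R) < N%:R by rewrite ltr0n.
  apply: (@le_trans _ _ (2^-1 ^+ N)).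
    apply: lerXn2r; rewrite ?nnegrE ?divr_ge0 ?(ltW tC)//.
    by rewrite ler_pdivrMr//; lra.
  apply: (@le_trans _ _ (N%:R^-1)).
    rewrite exprVn lef_pV2 ?posrE ?exprn_gt0//.
    by rewrite -natrX ler_nat ltnW// ltn_expl.
  by rewrite powRN -invfM lef_pV2 ?posrE ?mulr_gt0.
- exact: cvg_cst.
- apply/fine_cvgP; split; first by near=> n.
  apply: (@cvg_scaled_powRN_nat R c^-1); lra.
Unshelve. all: by end_near. Qed.

(** * Limit theorems for the number of critical penalties *)

(** The death of [k] lines is at most as likely as that of [k] independent ones,
so the central limit theorem for one line is raised to the power [k]. *)
Lemma limn_esup_num_critical (R : realType) (p x a L : R) (d : measure_display)
    (T : measurableType d) (P : probability T R)
    (omega : nat * nat -> {RV P >-> bool}) (k : nat) :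
  0 < p < 1 -> iid_bernoulli p omega -> a < 1 ->
  (p * x * n%:R `^ (a - 2^-1) @[n --> \oo] --> L) ->
  (limn_esup (fun n : nat => P [set t | (k <= num_critical R (fun v => omega v t)
     (m_ p x a n) n)%N]) <= (Phi (L / Num.sqrt (1 - p)) ^+ k)%:E)%E.
Proof.
move=> p01 iid a1 cvL; apply/lee_addgt0Pr => e e0.
set z := L / _; have z0 := Phi_ge0 z; have z1 := Phi_le1 z.
have t0 : (0 : R) < 3 ^+ k by rewrite exprn_gt0.
pose gamma : R := Num.min 1 (e / 3 ^+ k).
have g0 : 0 < gamma by rewrite lt_min ltr01 divr_gt0.
have g1 : gamma <= 1 by rewrite ge_min lexx.
have ge : 3 ^+ k * gamma <= e.
  by rewrite mulrC -ler_pdivlMr// ge_min lexx orbT.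
have [kappa k0 [M0 clt]] := death_clt p01 z g0.
have deficit := m_deficit p01 a1 k0 cvL.
apply: limn_esup_le_near; near=> n.
apply: le_trans (@prob_num_critical_ge _ _ _ _ _ _ p01 iid _ _ _ _) _.
  by near: n; exact: nbhs_infty_ge.
rewrite -EFinD lee_fin.
apply: (@le_trans _ _ ((Phi z + gamma) ^+ k)).
  apply: lerXn2r; rewrite ?nnegrE ?death_ge0//.
    by rewrite addr_ge0// ltW.
  by apply: clt; near: n; [exact: m_infty|exact: deficit].
apply: le_trans (exprD_le k _ _) _; first by rewrite z0.
  by rewrite (ltW g0).
by rewrite lerD2l.
Unshelve. all: by end_near. Qed.

Theorem theorem2p3 (R : realType) (p x : R) (hp : 0 < p < 1) :
  (forall (d : measure_display) (T : measurableType d) (P : probability T R)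
      (omega : nat * nat -> {RV P >-> bool}),
    iid_bernoulli p omega ->
    forall a : R, 0 < a <= 2^-1 -> forall k : nat,
      (limn_esup (fun n : nat =>
         P [set t | (k <= num_critical R (fun v => omega v t)
                            (m_ p x a n) n)%N])
       <= (if a < 2^-1 then 2 ^- k
           else Phi (x * p * (1 - p) `^ (- 2^-1)) ^+ k)%R%:E)%E)
  /\
  (exists C1 : R,
    forall (d : measure_display) (T : measurableType d) (P : probability T R)
      (omega : nat * nat -> {RV P >-> bool}),
    iid_bernoulli p omega ->
    forall a : R, 2^-1 < a <= 3 / 4 ->
      P [set t | C1 * n%:R `^ (2 * a - 1)
                 < (num_critical R (fun v => omega v t) (m_ p x a n) n)%:R]
        @[n --> \oo] --> 0%E)
  /\
  (exists C2 : R,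
    forall (d : measure_display) (T : measurableType d) (P : probability T R)
      (omega : nat * nat -> {RV P >-> bool}),
    iid_bernoulli p omega ->
    forall a : R, 3 / 4 < a < 1 ->
      P [set t | C2 * n%:R `^ (2 * a / 3)
                 < (num_critical R (fun v => omega v t) (m_ p x a n) n)%:R]
        @[n --> \oo] --> 0%E).
Proof.
have [B B0 few] := few_mismatches x hp.
have q0 : 0 < 1 - p by case/andP: hp => _; rewrite subr_gt0.
split; [|split].
- move=> d T P omega iid a /andP[a0 a12] k.
  have a1 : a < 1 by lra.
  case: ifPn => [alt|age].
    have -> : 2 ^- k = Phi (0 / Num.sqrt (1 - p)) ^+ k :> R.
      by rewrite mul0r Phi0 exprVn.
    apply: limn_esup_num_critical => //.
    rewrite -opprB; apply: cvg_scaled_powRN_nat; lra.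
  have {age a12} aE : a = 2^-1 by apply/eqP; rewrite eq_le a12 leNgt.
  have -> : x * p * (1 - p) `^ (- 2^-1) = (p * x) / Num.sqrt (1 - p).
    by rewrite powRN powR12_sqrt ?(ltW q0)// (mulrC x).
  apply: limn_esup_num_critical => //; rewrite aE.
  under eq_fun do rewrite subrr powRr0 mulr1.
  exact: cvg_cst.
- exists B => d T P omega iid a /andP[a12 a34].
  have a01 : 2^-1 < a < 1 by rewrite a12; lra.
  apply: (few d T P omega iid a a01 (fun n r => B * n%:R `^ (2 * a - 1) < r%:R)).
  move=> n j r n0 jB rj _; apply/negP; rewrite -leNgt; apply: le_trans jB.
  by rewrite ler_nat.
- exists (8 + 3 * B) => d T P omega iid a /andP[a34 a1].
  have a01 : 2^-1 < a < 1 by apply/andP; split; lra.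
  apply: (few d T P omega iid a a01 (fun n r => (8 + 3 * B) * n%:R `^ (2 * a / 3) < r%:R)).
  move=> n j r n0 jB _ cube; apply/negP; rewrite -leNgt.
  have n1 : (1 : R) <= n%:R by rewrite ler1n.
  have npos : (0 : R) < n%:R by rewrite ltr0n.
  pose u : R := n%:R `^ (a / 3).
  have u1 : 1 <= u.
    by rewrite -[leLHS](powRr0 (n%:R : R)) ler_powR//; lra.
  have na : n%:R `^ a = u ^+ 3 :> R.
    by rewrite /u -powR_mulrn ?powR_ge0// -powRrM; congr (_ `^ _); lra.
  have n2a : n%:R `^ (2 * a / 3) = u ^+ 2 :> R.
    by rewrite /u -powR_mulrn ?powR_ge0// -powRrM; congr (_ `^ _); lra.
  have jna : j%:R <= B * u ^+ 3.
    apply: le_trans jB _; rewrite ler_pM2l// -na ler_powR//; lra.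
  (* this cutoff balances [K ^ 3] with the bound on [j], both of order [n ^ a] *)
  pose K := (Num.truncn u).+1.
  have uK : u <= K%:R by exact/ltW/truncnS_gt.
  have K2 : K%:R <= 2 * u.
    have : (Num.truncn u)%:R <= u by rewrite truncn_le; lra.
    by rewrite /K -natr1; lra.
  have : K%:R * r%:R <= K%:R ^+ 3 + 3 * j%:R :> R.
    by rewrite -natrM -natrX -(natrM _ 3) -natrD ler_nat.
  have u0 : 0 < u by lra.
  have K3 : K%:R ^+ 3 <= (2 * u) ^+ 3 :> R.
    by apply: lerXn2r; rewrite ?nnegrE//; lra.
  have : u * r%:R <= K%:R * r%:R :> R by rewrite ler_wpM2r.
  move=> h1 h2; rewrite n2a -(ler_pM2l u0).
  apply: (le_trans h1); apply: (le_trans h2).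
  have -> : u * ((8 + 3 * B) * u ^+ 2) = (2 * u) ^+ 3 + 3 * (B * u ^+ 3) by ring.
  by lra.
Qed.
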